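(* Let $D$ be a digraph on $2n\ge 6$ vertices with minimum degree at least $2n-1$ and minimum semi-degree at least $n-1$. Then $D$ is hamiltonian (contains a directed cycle through all vertices) unless $D\in H(n,n)\cup H(n,n-1,1)$ or $D$ is isomorphic to one of $H(2n)$, $H'(2n)$, $D_6$, $D'_6$, $\overleftarrow{D_6}$, $\overleftarrow{D'_6}$.
   Context: Digraphs are finite, without loops or multiple arcs. For a vertex $x$, $O(x)$ and $I(x)$ are its out- and in-neighbourhoods, $od(x)=|O(x)|$, $id(x)=|I(x)|$, $d(x)=od(x)+id(x)$; the minimum semi-degree is $\min_x\min\{od(x),id(x)\}$. $\langle S\rangle$ is the induced subdigraph on $S$; $A\rightarrow B$ means every vertex of $A$ dominates every vertex of $B$. $K_n^*$ is the complete symmetric digraph on $n$ vertices (both arcs between every pair). The converse $\overleftarrow{D}$ is obtained from $D$ by reversing all arcs. $H(n,n)$: the set of digraphs on $2n$ vertices with $V=A\cup B$ (disjoint), $\langle A\rangle\cong\langle B\rangle\cong K_n^*$, no arc from $B$ to $A$, every vertex of $A$ dominates some vertex of $B$, and every vertex of $B$ is dominated by some vertex of $A$. $H(n,n-1,1)$ ($n\ge 2$): the set of digraphs on $2n$ vertices with $V=A\cup B\cup\{a\}$ (disjoint), $|A|=|B|+1=n$, no arcs inside $A$, $\langle B\cup\{a\}\rangle$ an arbitrary subdigraph of $K_n^*$ on these vertices, $yz$ and $zy$ arcs for every $y\in A$, $z\in B$, and either ($I(a)=B$ and $a\rightarrow A$) or ($O(a)=B$ and $A\rightarrow a$). $H(2n)$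 ($n\ge2$): vertex set $A\cup B\cup\{x,y\}$ with $\langle A\rangle\cong\langle B\rangle\cong K_{n-1}^*$, no arcs between $A$ and $B$, $O(x)=\{y\}\cup A$, $I(x)=O(y)=A\cup B$, $I(y)=\{x\}\cup B$. $H'(2n)$ is $H(2n)$ with the arc $yx$ added. $D_6$: vertex set $\{x_1,\dots,x_5,x\}$ and arc set $\{x_ix_{i+1}: 1\le i\le 4\}\cup\{xx_i: 1\le i\le 3\}\cup\{x_1x_5,x_2x_5,x_5x_1,x_5x_4,x_3x_2,x_3x,x_4x_1,x_4x\}$. $D'_6$ is $D_6$ with the arc $x_2x_4$ added. *)

(* Defs.v *)
From mathcomp Require Import all_boot.

Set Implicit Arguments.
Unset Strict Implicit.
Unset Printing Implicit Defensive.

(* A digraph is a relation on a finite type of vertices; having no loops is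
   the hypothesis [irreflexive D], and multiple arcs cannot occur. *)

Definition out_nbr (V : finType) (D : rel V) (x : V) : {set V} :=
  [set y | D x y].

Definition in_nbr (V : finType) (D : rel V) (x : V) : {set V} :=
  [set y | D y x].

Definition outdeg (V : finType) (D : rel V) (x : V) : nat := #|out_nbr D x|.

Definition indeg (V : finType) (D : rel V) (x : V) : nat := #|in_nbr D x|.

Definition degree (V : finType) (D : rel V) (x : V) : nat :=
  outdeg D x + indeg D x.

Definition dominates (V : finType) (D : rel V) (A B : {set V}) : Prop :=
  forall x y, x \in A -> y \in B -> D x y.

Definition no_arc (V : finType) (D : rel V) (A B : {set V}) : Prop :=
  forall x y, x \in A -> y \in B -> ~~ D x y.

Definition induced (V : finType) (D : rel V) (S : {set V}) :
  rel {x : V | x \in S} := fun x y => D (val x) (val y).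
Arguments induced {V} D S _ _.

Definition converse (V : finType) (D : rel V) : rel V := fun x y => D y x.

Definition diso (V W : finType) (D : rel V) (E : rel W) : Prop :=
  exists2 f : V -> W, bijective f & forall x y, E (f x) (f y) = D x y.

Definition complete_digraph (n : nat) : rel 'I_n := fun i j => i != j.
Arguments complete_digraph n _ _ : clear implicits.

Definition hamiltonian (V : finType) (D : rel V) : Prop :=
  exists c : seq V, [/\ 1 < size c, ucycle D c & forall x, x \in c].

Definition in_Hnn (n : nat) (V : finType) (D : rel V) : Prop :=
  exists A B : {set V},
    [/\ A :|: B = [set: V] /\ [disjoint A & B],
        diso (induced D A) (complete_digraph n),
        diso (induced D B) (complete_digraph n),
        no_arc D B A
      & (forall x, x \in A -> exists2 y, y \in B & D x y) /\
        (forall y, y \in B -> exists2 x, x \in A & D x y)].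

(* The subdigraph induced on [a |: B] is
   constrained only through the neighbourhoods of [a]. *)
Definition in_Hnn11 (n : nat) (V : finType) (D : rel V) : Prop :=
  exists (A B : {set V}) (a : V),
    [/\ [/\ A :|: B :|: [set a] = [set: V], [disjoint A & B],
            a \notin A & a \notin B],
        #|A| = n /\ #|B| + 1 = n,
        no_arc D A A,
        dominates D A B /\ dominates D B A
      & (in_nbr D a = B /\ dominates D [set a] A) \/
        (out_nbr D a = B /\ dominates D A [set a])].

(* In the vertex type of H(2n), [inl (inl _)] ranges over A, [inl (inr _)]
   over B, and [inr true], [inr false] are x and y. *)
Definition H2n_vertex (n : nat) : finType := ('I_n.-1 + 'I_n.-1 + bool)%type.

Definition H2n (n : nat) : rel (H2n_vertex n) := fun u v =>
  match u, v with
  | inl (inl i), inl (inl j) => i != j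
  | inl (inr i), inl (inr j) => i != j
  | inl (inl _), inl (inr _) => false
  | inl (inr _), inl (inl _) => false
  | inl _, inr true => true
  | inl (inl _), inr false => false
  | inl (inr _), inr false => true
  | inr true, inl (inl _) => true
  | inr true, inl (inr _) => false
  | inr true, inr false => true
  | inr false, inl _ => true
  | inr false, inr true => false
  | inr true, inr true => false
  | inr false, inr false => false
  end.
Arguments H2n n _ _ : clear implicits.

Definition H2n' (n : nat) : rel (H2n_vertex n) := fun u v =>
  H2n n u v || (u == inr false) && (v == inr true).
Arguments H2n' n _ _ : clear implicits.

(* The vertices x_1, ..., x_5 are 1, ..., 5, and x is 0. *)
Definition D6_arcs : seq (nat * nat) :=
  [:: (1, 2); (2, 3); (3, 4); (4, 5);
      (0, 1); (0, 2); (0, 3);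
      (1, 5); (2, 5); (5, 1); (5, 4); (3, 2); (3, 0); (4, 1); (4, 0)].

Definition D6 : rel 'I_6 := fun i j => (val i, val j) \in D6_arcs.

Definition D6' : rel 'I_6 := fun i j => (val i, val j) \in (2, 4) :: D6_arcs.

(* Main.v *)
(* If [D] is not strong, the degree conditions force two complete halves of order
   [n].  Let [D] be strong and not hamiltonian.  Take a longest cycle, a path
   bypassing a segment [g] of it, and choose the two with [g] shortest.  Meyniel's
   degree count for a vertex of [g] and a vertex of the bypass, whose degrees add
   up to at least [4 * n - 2], is then tight everywhere: the rest [q] of the cycle
   is a path, and the vertices off [q] form two disjoint complete digraphs [g] and
   [Y] of the same order without arcs between them, each vertex [v] of which gets
   an arc from the end of [q], sends one to its start, and satisfies [v -> b] iff
   not [a -> v] for each step [a -> b] of [q].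

   If [g] has at least two vertices, [q] is a single arc and [D] is [H(2n)] or
   [H'(2n)].  If [g] and [Y] are single vertices [v] and [y], compare the sets of
   positions on [q] from which [v] and [y] are dominated.  If these are the same,
   and remain so whenever a vertex of [q] is exchanged with [y], the vertices not
   dominating [y] and those not dominated by [y] violate Hall's condition for a
   cycle factor, which gives [H(n,n-1,1)].  If not, counting degrees shows first
   that the two sets are complementary and then that [n = 3]; the digraphs on six
   vertices are enumerated. *)

Require Import Defs.
From mathcomp Require Import all_boot.
From mathcomp Require Import zify.

Set Implicit Arguments.
Unset Strict Implicit.
Unset Printing Implicit Defensive.

(** The count on the longest cycle has one asymmetry. A vertex off the cycle cannot be inserted into
    [q], or the cycle would grow; a vertex of [g] might be, since it already lies on the cycle. So
    vertices of [g] are inserted into [q] until the remaining ones fit nowhere. Some remain, because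
    otherwise the bypass would close the enlarged path to a longer cycle, and the count is made for
    one of these. Minimality of [g] means that no walk off the cycle starting at the end of [q]
    enters [g], and none from [g] reaches the start of [q]; hence a vertex of [g] and one of the
    bypass share at most two arcs with any further vertex off the cycle.

    For single-vertex blobs put [h = n - 1]. Tightness makes the out-neighbours of an end a function
    of its in-neighbours, so an end amounts to a 0/1 word on the positions [1, ..., 2 * h - 1] of
    [q]. Where the word drops from 1 to 0, the path can be cut and reassembled with another vertex
    as an end, which is then tight as well. Comparing the words of the two ends at such drops
    decides all cases. *)

Lemma sum_nat_eq_termwise (F G : nat -> nat) (m n : nat) :
  (forall i, m <= i < n -> F i <= G i) ->
  \sum_(m <= i < n) G i <= \sum_(m <= i < n) F i ->
  forall i, m <= i < n -> F i = G i.
Proof.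
move=> leFG leS i /andP[mi iN].
have split_at (H : nat -> nat) : \sum_(m <= j < n) H j =
    \sum_(m <= j < i) H j + (H i + \sum_(i.+1 <= j < n) H j).
  by rewrite (@big_cat_nat _ _ _ i) ?(ltnW iN) //= [X in _ + X]big_ltn.
have le1 : \sum_(m <= j < i) F j <= \sum_(m <= j < i) G j.
  rewrite !big_nat; apply: leq_sum => j /andP[mj ji]; apply: leFG.
  by rewrite mj (ltn_trans ji).
have le2 : \sum_(i.+1 <= j < n) F j <= \sum_(i.+1 <= j < n) G j.
  rewrite !big_nat; apply: leq_sum => j /andP[ij jn]; apply: leFG.
  by rewrite jn andbT; lia.
have := leFG i; rewrite mi iN => /(_ isT).
by move: leS; rewrite !split_at; lia.
Qed.

Lemma sum_nat_pred1 (m n i : nat) :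
  m <= i < n -> \sum_(m <= j < n) (j == i) = 1.
Proof.
move=> /andP[mi iN].
rewrite (@big_cat_nat _ _ _ i) ?(ltnW iN) //= [X in _ + X]big_ltn // eqxx.
rewrite !big_nat !big1 // => j jP; case: eqP => // ?; lia.
Qed.

Lemma sum_nat_negb (P : nat -> bool) (m n : nat) :
  \sum_(m <= i < n) P i + \sum_(m <= i < n) ~~ P i = n - m.
Proof.
rewrite -big_split /= (eq_bigr (fun=> 1)) => [|i _]; last by case: (P i).
by rewrite sum_nat_const_nat muln1.
Qed.

(** * Hamiltonian cycles from segments of a Hamiltonian path *)

Section BlockCycles.

Variables (V : finType) (D : rel V) (N : nat) (q : nat -> V).
Hypothesis q_surj : forall x, exists2 i, i < N & x = q i.
Hypothesis q_inj : forall i j, i < N -> j < N -> q i = q j -> i = j.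
Hypothesis q_path : forall i, i.+1 < N -> D (q i) (q i.+1).

Let block (b : nat * nat) : seq nat := iota b.1 (b.2.+1 - b.1).

Lemma perm_enum_index : perm_eq (map q (iota 0 N)) (enum V).
Proof.
apply: uniq_perm; rewrite ?enum_uniq //.
  rewrite map_inj_in_uniq ?iota_uniq // => i j.
  by rewrite !mem_iota !add0n => /andP[_ iN] /andP[_ jN]; apply: q_inj.
move=> x; rewrite mem_enum inE; have [i iN ->] := q_surj x.
by rewrite map_f // mem_iota.
Qed.

Lemma outdeg_index x : outdeg D x = \sum_(0 <= i < N) D x (q i).
Proof.
rewrite /outdeg cardE /enum_mem size_filter -enumT.
rewrite (eq_count (a2 := D x)) => [|z]; last by rewrite !inE.
rewrite -(permP perm_enum_index) count_map -sumn_count /index_iota subn0.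
by rewrite sumnE big_map.
Qed.

Lemma indeg_index x : indeg D x = \sum_(0 <= i < N) D (q i) x.
Proof.
rewrite /indeg cardE /enum_mem size_filter -enumT.
rewrite (eq_count (a2 := fun z => D z x)) => [|z]; last by rewrite !inE.
rewrite -(permP perm_enum_index) count_map -sumn_count /index_iota subn0.
by rewrite sumnE big_map.
Qed.

(* A pair [(i, j)] of [bl] stands for the segment [q i, ..., q j] of the path. *)
Lemma hamiltonian_blocks (bl : seq (nat * nat)) :
  1 < N ->
  all (fun b => b.1 <= b.2 < N) bl ->
  cycle (fun b b' => D (q b.2) (q b'.1)) bl ->
  sumn (map (fun b => b.2.+1 - b.1) bl) = N ->
  (forall x, x < N -> has (fun b => b.1 <= x <= b.2) bl) ->
  hamiltonian D.
Proof.
move=> N_gt1 bl_le bl_cyc bl_size bl_cover.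
have pathb i j : i <= j < N ->
    path D (q i) (map q (iota i.+1 (j - i))) /\
    last (q i) (map q (iota i.+1 (j - i))) = q j.
  move=> /andP[ij jN]; move: {2}(j - i) (erefl (j - i)) => d.
  elim: d i ij => [|d IH] i ij e.
    by rewrite e /=; split=> //; congr q; lia.
  have -> : j - i = (j - i.+1).+1 by lia.
  have [||p l] := IH i.+1; [by lia|by lia|].
  by rewrite /= p l q_path //; lia.
have blockE b : b.1 <= b.2 -> block b = b.1 :: iota b.1.+1 (b.2 - b.1).
  by move=> le; rewrite /block subSn.
pose c := flatten (map block bl).
have szc : size c = N.
  rewrite size_flatten /shape -map_comp -[RHS]bl_size; congr sumn.
  by apply: eq_map => b /=; rewrite size_iota.
have subc : {subset iota 0 N <= c}.
  move=> x; rewrite mem_iota add0n => /andP[_ xN].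
  have /hasP[b bin /andP[bx xb]] := bl_cover _ xN.
  apply/flattenP; exists (block b); first by apply: map_f.
  by rewrite mem_iota; lia.
(* The blocks cover [N] positions with total length [N], so no position is repeated. *)
have uc : uniq c.
  apply: (leq_size_uniq (iota_uniq 0 N) subc).
  by rewrite szc size_iota.
have eqc : c =i iota 0 N.
  have [] := @uniq_min_size _ (iota 0 N) c (iota_uniq 0 N) subc.
    by rewrite szc size_iota.
  by move=> _ e x; rewrite e.
exists (map q c); split.
- by rewrite size_map szc.
- rewrite /ucycle; apply/andP; split; last first.
    rewrite map_inj_in_uniq // => i j; rewrite !eqc !mem_iota !add0n.
    by move=> /andP[_ iN] /andP[_ jN]; apply: q_inj.
  have {bl_size bl_cover szc subc uc eqc}: c = flatten (map block bl) by [].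
  case: bl bl_le bl_cyc @c => [|b bl] bl_le bl_cyc c -> //=.
  move: bl_le => /= /andP[bP bl_le]; rewrite blockE; last by lia.
  have walk b' bl' : b'.1 <= b'.2 < N -> all (fun b => b.1 <= b.2 < N) bl' ->
      path (fun b b' => D (q b.2) (q b'.1)) b' bl' ->
      path D (q b'.1) (map q (iota b'.1.+1 (b'.2 - b'.1) ++
                             flatten (map block bl'))) /\
      last (q b'.1) (map q (iota b'.1.+1 (b'.2 - b'.1) ++
                             flatten (map block bl'))) = q (last b' bl').2.
    elim: bl' b' => [|b2 bl2 IH] b' b'P /=; have [p l] := pathb _ _ b'P.
      by rewrite cats0.
    move=> /andP[b2P bl2P] /andP[arc pp]; have [p2 l2] := IH _ b2P bl2P pp.
    rewrite map_cat cat_path last_cat l p blockE; last by lia.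
    by rewrite /= arc p2 l2.
  move: bl_cyc; rewrite /= rcons_path => /andP[pp arc].
  have [p l] := walk _ _ bP bl_le pp.
  by rewrite rcons_path p l arc.
move=> x; have [i iN ->] := q_surj x.
by apply: map_f; rewrite eqc mem_iota.
Qed.

End BlockCycles.

(** * Paths with exchangeable ends *)

(* [q 1, ..., q k.+1] is a cycle of length [k.+1 = 2 * h + 1] missing only [q 0],
   and [q 0] may take the place of [q k.+1] on it. *)
Definition interlaced (V : finType) (D : rel V) (h : nat) (q : nat -> V) :=
  [/\ forall x, exists2 i, i < 2 * h + 2 & x = q i,
      forall i j, i < 2 * h + 2 -> j < 2 * h + 2 -> q i = q j -> i = j,
      forall i, i <= 2 * h -> D (q i) (q i.+1),
      D (q (2 * h)) (q 0) & D (q (2 * h).+1) (q 1)].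

(** [h] stands for [n - 1]; the bounds are then those of the theorem. *)
Record nonham_dense (V : finType) (h : nat) (D : rel V) : Prop := NonhamDense {
  dense_loopless : irreflexive D;
  dense_degree : forall x, 2 * h + 1 <= degree D x;
  dense_outdeg : forall x, h <= outdeg D x;
  dense_indeg : forall x, h <= indeg D x;
  dense_order : 2 <= h;
  dense_nonham : ~ hamiltonian D
}.

Lemma sum_nat_ends (F : nat -> nat) (k : nat) : 0 < k ->
  \sum_(0 <= i < k + 2) F i = F 0 + \sum_(1 <= i < k) F i + F k + F k.+1.
Proof.
move=> k_gt0; rewrite addn2 big_nat_recr //= big_nat_recr //= big_ltn //.
Qed.

Lemma sum_nat_shift (F : nat -> nat) (k : nat) : 1 < k ->
  \sum_(1 <= i < k) F i + F k = F 1 + \sum_(1 <= i < k) F i.+1.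
Proof.
move=> k_gt1; rewrite -(@big_nat_recr _ _ _ k 1 F) /=; last by lia.
by rewrite big_ltn ?big_add1 //; lia.
Qed.

Definition swap_ends (V : Type) (h : nat) (q : nat -> V) i :=
  q (if i == 0 then (2 * h).+1 else if i == (2 * h).+1 then 0 else i).

Lemma swap_endsE (V : Type) (h : nat) (q : nat -> V) :
  (swap_ends h q 0 = q (2 * h).+1) * (swap_ends h q (2 * h).+1 = q 0).
Proof. by rewrite /swap_ends /= eqxx. Qed.

Lemma swap_ends_mid (V : Type) (h : nat) (q : nat -> V) i :
  1 <= i <= 2 * h -> swap_ends h q i = q i.
Proof. by rewrite /swap_ends; do !case: eqP => //; lia. Qed.

Section Interlaced.

Variables (V : finType) (D : rel V) (h : nat).
Hypothesis crit : nonham_dense h D.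

Let D_loopless := dense_loopless crit.
Let degree_ge := dense_degree crit.
Let h_ge2 := dense_order crit.
Let not_ham := dense_nonham crit.

Local Notation k := (2 * h).

Lemma interlaced_reindex q (f g : nat -> nat) :
  interlaced D h q ->
  (forall i, i < k + 2 -> [/\ f i < k + 2, g i < k + 2, g (f i) = i & f (g i) = i]) ->
  (forall i, i <= k -> D (q (f i)) (q (f i.+1))) ->
  D (q (f k)) (q (f 0)) -> D (q (f k.+1)) (q (f 1)) ->
  interlaced D h (fun i => q (f i)).
Proof.
case=> surj inj _ _ _ fg arcs fk fv; split=> //.
  move=> x; have [i iN ->] := surj x; have [_ gN _ e] := fg i iN.
  by exists (g i); rewrite ?e.
move=> i j iN jN; have [fi _ gi _] := fg i iN; have [fj _ gj _] := fg j jN.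
by move=> /inj -/(_ fi fj) e; rewrite -gi e gj.
Qed.

Lemma interlaced_swap q : interlaced D h q -> interlaced D h (swap_ends h q).
Proof.
move=> iq; case: (iq) => surj inj arcs qk0 qv1.
pose f i := if i == 0 then k.+1 else if i == k.+1 then 0 else i.
have fN i : i < k + 2 -> f i < k + 2 /\ f (f i) = i.
  by rewrite /f; do !case: eqP; lia.
have fid i : 1 <= i <= k -> f i = i by rewrite /f; do !case: eqP; lia.
have fv : f k.+1 = 0 by rewrite /f eqxx.
apply: (@interlaced_reindex q f f) => //.
- by move=> i /fN[? ?]; split.
- move=> i ik; have [->|i0] := eqVneq i 0; first by rewrite (fid 1) //; lia.
  rewrite (fid i); last by lia.
  have [->|ik'] := eqVneq i k; first by rewrite fv.
  by rewrite (fid i.+1); [apply: arcs | lia].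
- by rewrite (fid k); [apply: arcs | lia].
by rewrite fv (fid 1); [apply: arcs | lia].
Qed.

Section OneCycle.

Variable q : nat -> V.
Hypothesis iq : interlaced D h q.

Lemma no_cycle (bl : seq (nat * nat)) :
  all (fun b => b.1 <= b.2 < k + 2) bl ->
  cycle (fun b b' => D (q b.2) (q b'.1)) bl ->
  sumn (map (fun b => b.2.+1 - b.1) bl) = k + 2 ->
  (forall x, x < k + 2 -> has (fun b => b.1 <= x <= b.2) bl) -> False.
Proof.
case: iq => surj inj arcs _ _ le cyc sz cov; apply: not_ham.
apply: (@hamiltonian_blocks _ D (k + 2) q surj inj _ bl) => //; last by lia.
by move=> i iN; apply: arcs; lia.
Qed.

Lemma path_arc i : i <= k -> D (q i) (q i.+1).
Proof. by case: iq => _ _ + _ _; apply. Qed.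

Lemma arc_k0 : D (q k) (q 0). Proof. by case: iq. Qed.
Lemma arc_v1 : D (q k.+1) (q 1). Proof. by case: iq. Qed.
Lemma arc_01 : D (q 0) (q 1). Proof. exact: path_arc. Qed.
Lemma arc_kv : D (q k) (q k.+1). Proof. exact: path_arc. Qed.

Lemma outdegE x : outdeg D x = \sum_(0 <= i < k + 2) D x (q i).
Proof. by case: iq => surj inj _ _ _; apply: outdeg_index. Qed.

Lemma indegE x : indeg D x = \sum_(0 <= i < k + 2) D (q i) x.
Proof. by case: iq => surj inj _ _ _; apply: indeg_index. Qed.

Ltac close_cycle bl :=
  apply: (@no_cycle bl); rewrite /= ?arc_k0 ?arc_v1 ?arc_01 ?arc_kv;
  [lia | | lia | by move=> *; lia].

(** Each end fits between [q k] and [q 1], so an arc between the ends would let both be visited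
    there. *)
Lemma ends_nonadj : (D (q 0) (q k.+1) = false) * (D (q k.+1) (q 0) = false).
Proof.
split; apply/negP => arc.
  by close_cycle [:: (1, k); (0, 0); (k.+1, k.+1)]; rewrite arc.
by close_cycle [:: (1, k); (k.+1, k.+1); (0, 0)]; rewrite arc.
Qed.

(** [q 0] cannot be inserted into the cycle [q 1, ..., q k.+1], so each of the [k - 1] steps carries
    at most one of the two arcs. With [q k -> q 0] and [q 0 -> q 1] this allows degree at most
    [k + 1], which is also the lower bound. *)
Lemma tight0 i : 1 <= i < k -> D (q 0) (q i.+1) = ~~ D (q i) (q 0).
Proof.
have le1 j : 1 <= j < k -> D (q j) (q 0) + D (q 0) (q j.+1) <= 1.
  move=> jk; case: (boolP (D (q j) (q 0))) => [a1|_]; last by case: (D _ _).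
  case: (boolP (D (q 0) (q j.+1))) => // a2; exfalso.
  by close_cycle [:: (1, j); (0, 0); (j.+1, k.+1)]; rewrite a1 a2.
have := @sum_nat_eq_termwise
  (fun j => D (q j) (q 0) + D (q 0) (q j.+1)) (fun=> 1) 1 k le1.
rewrite sum_nat_const_nat muln1 big_split /=.
have := degree_ge (q 0); rewrite /degree outdegE indegE.
rewrite !sum_nat_ends ?(D_loopless, ends_nonadj) ?arc_k0; try lia.
have -> : \sum_(1 <= i < k) D (q 0) (q i) + D (q 0) (q k) =
    1 + \sum_(1 <= i < k) D (q 0) (q i.+1).
  rewrite -[LHS](@big_nat_recr _ _ _ k 1 (fun i => nat_of_bool (D (q 0) (q i))));
    last by lia.
  by rewrite big_ltn ?arc_01 ?big_add1 //; lia.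
by move=> le /(_ _) eq1 /eq1; case: (D (q i) _); case: (D (q 0) _) => //; lia.
Qed.

Lemma indeg0 : indeg D (q 0) = (\sum_(1 <= i < k) D (q i) (q 0)).+1.
Proof.
rewrite indegE sum_nat_ends; last by lia.
by rewrite D_loopless ends_nonadj arc_k0 addn0 addn1.
Qed.

Lemma outdeg0 : outdeg D (q 0) = (\sum_(1 <= i < k) ~~ D (q i) (q 0)).+1.
Proof.
rewrite outdegE sum_nat_ends; last by lia.
rewrite D_loopless ends_nonadj add0n addn0.
rewrite (sum_nat_shift (fun i => D (q 0) (q i))); last by lia.
rewrite arc_01 add1n; congr _.+1.
by apply: eq_big_nat => i /tight0 ->.
Qed.

(** The chord [q i -> q j] skips the segment from [q i.+1] to [q j.-1]. If [q i] did not dominate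
    [q 0], tightness would give [q 0 -> q i.+1], and the skipped segment could be visited between
    [q 0] and [q k.+1]. *)
Lemma forward0 i j : 1 <= i -> i.+1 < j <= k ->
  D (q i) (q j) -> D (q j.-1) (q k.+1) -> D (q i) (q 0).
Proof.
move=> i_gt0 ij ij_arc cj; apply: contraT => ai; exfalso.
close_cycle [:: (1, i); (j, k); (0, 0); (i.+1, j.-1); (k.+1, k.+1)].
by rewrite ij_arc tight0 ?ai ?cj //; lia.
Qed.

End OneCycle.

Section TwoEnds.

Variable q : nat -> V.
Hypothesis iq : interlaced D h q.

Let iq' := interlaced_swap iq.

Lemma tightv i : 1 <= i < k -> D (q k.+1) (q i.+1) = ~~ D (q i) (q k.+1).
Proof.
by move=> ik; have := tight0 iq' ik; rewrite swap_endsE !swap_ends_mid //; lia.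
Qed.

Lemma indegv : indeg D (q k.+1) = (\sum_(1 <= i < k) D (q i) (q k.+1)).+1.
Proof.
have := indeg0 iq'; rewrite swap_endsE => ->; congr _.+1.
by apply: eq_big_nat => i ik; rewrite swap_ends_mid //; lia.
Qed.

Lemma outdegv : outdeg D (q k.+1) = (\sum_(1 <= i < k) ~~ D (q i) (q k.+1)).+1.
Proof.
have := outdeg0 iq'; rewrite swap_endsE => ->; congr _.+1.
by apply: eq_big_nat => i ik; rewrite swap_ends_mid //; lia.
Qed.

Lemma forwardv i j : 1 <= i -> i.+1 < j <= k ->
  D (q i) (q j) -> D (q j.-1) (q 0) -> D (q i) (q k.+1).
Proof.
move=> i_gt0 ij; have := @forward0 _ iq' i j i_gt0 ij.
by rewrite !swap_endsE !swap_ends_mid //; lia.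
Qed.

(* The vertex [q l.+1] can trade places with [q 0]: cutting the path there puts
   it in the role of the end [q k.+1]. *)
Definition rotate l i := q (if i == 0 then 0 else
  if i <= k - l then i + l.+1 else i - (k - l)).

(** The new order is [q 0, q l.+2, ..., q k.+1, q 1, ..., q l.+1]. Its arc out of [q 0] comes from
    tightness, as [q l.+1] does not dominate [q 0]; the arc back to [q 0] is [q l -> q 0]. *)
Lemma interlaced_rotate l : 1 <= l -> l.+1 < k ->
  D (q l) (q 0) -> ~~ D (q l.+1) (q 0) -> interlaced D h (rotate l).
Proof.
move=> l_gt0 lk al al1.
pose f i := if i == 0 then 0 else if i <= k - l then i + l.+1 else i - (k - l).
pose g i := if i == 0 then 0 else if i <= l.+1 then i + (k - l) else i - l.+1.
apply: (@interlaced_reindex q f g) => //.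
- move=> i iN.
  have [->|i0] := eqVneq i 0; first by rewrite /f /g /=; split=> //; lia.
  have f1 j : 0 < j <= k - l -> f j = j + l.+1.
    by rewrite /f => jP; rewrite ifF ?ifT //; lia.
  have f2 j : k - l < j -> f j = j - (k - l).
    by rewrite /f => jP; rewrite !ifF //; lia.
  have g1 j : 0 < j <= l.+1 -> g j = j + (k - l).
    by rewrite /g => jP; rewrite ifF ?ifT //; lia.
  have g2 j : l.+1 < j -> g j = j - l.+1.
    by rewrite /g => jP; rewrite !ifF //; lia.
  have fP : [/\ f i < k + 2 & g (f i) = i].
    case: (leqP i (k - l)) => i1; first by rewrite f1 ?g2; lia || split; lia.
    by rewrite f2 ?g1; lia || split; lia.
  have gP : [/\ g i < k + 2 & f (g i) = i].
    case: (leqP i l.+1) => i1; first by rewrite g1 ?f2; lia || split; lia.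
    by rewrite g2 ?f1; lia || split; lia.
  by case: fP => ? ?; case: gP.
- move=> i ik; have [->|i0] := eqVneq i 0.
    rewrite /f /=; have -> : (1 <= k - l) = true by lia.
    by rewrite add1n (tight0 iq) ?al1 //; lia.
  have [->|ikl] := eqVneq i (k - l).
    rewrite /f; have -> : (k - l == 0) = false by lia.
    rewrite leqnn /= ltnn; have -> : k - l + l.+1 = k.+1 by lia.
    have -> : (k - l).+1 - (k - l) = 1 by lia.
    exact: (arc_v1 iq).
  have -> : f i.+1 = (f i).+1.
    rewrite /f (negPf i0) /=; case: (leqP i (k - l)) => ikl'.
      by rewrite ifT; lia.
    by rewrite ifF; lia.
  apply: (path_arc iq); rewrite /f (negPf i0).
  by case: (leqP i (k - l)) => ikl'; lia.
- rewrite /f eqxx; have -> : (k == 0) = false by lia.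
  have -> : (k <= k - l) = false by lia.
  by have -> : k - (k - l) = l by lia.
rewrite /f /=; have -> : (k.+1 <= k - l) = false by lia.
have -> : (1 <= k - l) = true by lia.
have -> : k.+1 - (k - l) = l.+1 by lia.
by apply: (path_arc iq); lia.
Qed.

End TwoEnds.
End Interlaced.

Lemma sum_nat_le (F G : nat -> nat) (m n : nat) :
  (forall i, m <= i < n -> F i <= G i) ->
  \sum_(m <= i < n) F i <= \sum_(m <= i < n) G i.
Proof. by move=> leFG; rewrite !big_nat; apply: leq_sum. Qed.

(** * Ends that are not twins *)

Section NonTwins.

Variables (V : finType) (D : rel V) (h : nat).
Hypothesis crit : nonham_dense h D.

Let D_loopless := dense_loopless crit.
Let h_ge2 := dense_order crit.

Local Notation k := (2 * h).

(** By tightness, ends with the same in-neighbours also have the same out-neighbours. *)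
Definition twin_ends (q : nat -> V) :=
  forall i, 1 <= i < k -> D (q i) (q 0) = D (q i) (q k.+1).

Lemma twin_swap q : twin_ends (swap_ends h q) -> twin_ends q.
Proof.
move=> tw i ik; have := tw i ik.
by rewrite !swap_endsE swap_ends_mid; [move=> -> | lia].
Qed.

Lemma degree0 q : interlaced D h q -> degree D (q 0) = k.+1.
Proof.
move=> iq; have := indeg0 crit iq; have := outdeg0 crit iq; rewrite /degree.
have := sum_nat_negb (fun i => D (q i) (q 0)) 1 k.
lia.
Qed.

Lemma degreev q : interlaced D h q -> degree D (q k.+1) = k.+1.
Proof. by move=> /(interlaced_swap crit)/degree0; rewrite swap_endsE. Qed.

Section Path.

Variable q : nat -> V.
Hypothesis iq : interlaced D h q.

Ltac arith :=
  repeat match goal with H : context [D] |- _ => clear H end;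
  intros; simpl; lia.

Ltac close_cycle bl :=
  apply: (no_cycle crit iq (bl := bl)); [arith | | arith | arith].

(** By the chord lemmas an arc [q 1 -> q i.+1] with [i >= 2] forces [q i] to dominate neither end.
    So the out-degree of [q 1] provides [h] positions dominating neither end, while the in-degree of
    each end leaves at most [h] positions that do not dominate it. Both sets of missing positions
    are therefore the common one. *)
Lemma twin_first :
  ~~ D (q 1) (q 0) -> ~~ D (q 1) (q k.+1) -> twin_ends q.
Proof.
move=> a1 c1.
have le0 i : 2 <= i < k -> nat_of_bool (D (q 1) (q i.+1)) <=
    ~~ D (q i) (q 0) && ~~ D (q i) (q k.+1).
  move=> ik; case arc: (D (q 1) (q i.+1)) => //.
  rewrite lt0b; apply/andP; split; [apply: contra c1 | apply: contra a1] => ai.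
    by apply: (forwardv crit iq (j := i.+1)) => //; lia.
  by apply: (forward0 crit iq (j := i.+1)) => //; lia.
have le1 : h <= \sum_(1 <= i < k) (~~ D (q i) (q 0) && ~~ D (q i) (q k.+1)).
  apply: leq_trans (dense_outdeg crit (q 1)) _.
  rewrite (outdegE iq) sum_nat_ends; last by lia.
  rewrite (negPf a1) (negPf c1) add0n addn0.
  rewrite (sum_nat_shift (fun i => D (q 1) (q i))); last by lia.
  rewrite D_loopless add0n !(@big_ltn _ _ _ 1); [|lia..].
  rewrite a1 c1 leq_add ?leq_b1 //.
  by apply: sum_nat_le => i ik; apply: le0; lia.
have le2 : h <= (\sum_(1 <= i < k) D (q i) (q 0)).+1.
  by rewrite -(indeg0 crit iq) dense_indeg.
have le3 : h <= (\sum_(1 <= i < k) D (q i) (q k.+1)).+1.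
  by rewrite -(indegv crit iq) dense_indeg.
have eq0 := sum_nat_negb (fun i => D (q i) (q 0)) 1 k.
have eqv := sum_nat_negb (fun i => D (q i) (q k.+1)) 1 k.
move=> i ik.
have e1 := @sum_nat_eq_termwise
  (fun i => ~~ D (q i) (q 0) && ~~ D (q i) (q k.+1))
  (fun i => ~~ D (q i) (q 0)) 1 k _ _ i ik.
have e2 := @sum_nat_eq_termwise
  (fun i => ~~ D (q i) (q 0) && ~~ D (q i) (q k.+1))
  (fun i => ~~ D (q i) (q k.+1)) 1 k _ _ i ik.
move: e1 e2; do 2!case: (D (q i) _) => //=; move=> e1 e2.
  suff: 0 = 1 by []; apply: e2 => [j _|]; last by lia.
  by do 2!case: (D (q j) _).
suff: 0 = 1 by []; apply: e1 => [j _|]; last by lia.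
by do 2!case: (D (q j) _).
Qed.

(** The mirror image at the other end of the path: every in-neighbour of [q k] dominates both ends,
    which gives [h] common in-neighbours, and the out-degree of each end allows it no more than [h]
    among the positions [1, ..., k - 1]. *)
Lemma twin_last :
  D (q k.-1) (q 0) -> D (q k.-1) (q k.+1) -> twin_ends q.
Proof.
move=> a1 c1.
have le0 i : 1 <= i < k.-1 -> nat_of_bool (D (q i) (q k)) <=
    D (q i) (q 0) && D (q i) (q k.+1).
  move=> ik; case arc: (D (q i) (q k)) => //.
  rewrite lt0b; apply/andP; split.
    by apply: (forward0 crit iq (j := k)) => //; lia.
  by apply: (forwardv crit iq (j := k)) => //; lia.
have kk : k = k.-1.+1 by lia.
have y_k : D (q 0) (q k) = false.
  by rewrite {1}kk (tight0 crit iq) ?a1 //; lia.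
have v_k : D (q k.+1) (q k) = false.
  by rewrite {2}kk (tightv crit iq) ?c1 //; lia.
have le1 : h <= \sum_(1 <= i < k) (D (q i) (q 0) && D (q i) (q k.+1)).
  apply: leq_trans (dense_indeg crit (q k)) _.
  rewrite (indegE iq) sum_nat_ends; last by lia.
  rewrite y_k v_k D_loopless add0n !addn0 {1 3}kk !big_nat_recr; [|lia..].
  rewrite /= a1 c1 leq_add ?leq_b1 //.
  by apply: sum_nat_le => i ik; apply: le0; lia.
have le2 : h <= (\sum_(1 <= i < k) ~~ D (q i) (q 0)).+1.
  by rewrite -(outdeg0 crit iq) dense_outdeg.
have le3 : h <= (\sum_(1 <= i < k) ~~ D (q i) (q k.+1)).+1.
  by rewrite -(outdegv crit iq) dense_outdeg.
have eq0 := sum_nat_negb (fun i => D (q i) (q 0)) 1 k.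
have eqv := sum_nat_negb (fun i => D (q i) (q k.+1)) 1 k.
move=> i ik.
have e1 := @sum_nat_eq_termwise
  (fun i => D (q i) (q 0) && D (q i) (q k.+1))
  (fun i => D (q i) (q 0)) 1 k _ _ i ik.
have e2 := @sum_nat_eq_termwise
  (fun i => D (q i) (q 0) && D (q i) (q k.+1))
  (fun i => D (q i) (q k.+1)) 1 k _ _ i ik.
move: e1 e2; do 2!case: (D (q i) _) => //=; move=> e1 e2.
  suff: 0 = 1 by []; apply: e1 => [j _|]; last by lia.
  by do 2!case: (D (q j) _).
suff: 0 = 1 by []; apply: e2 => [j _|]; last by lia.
by do 2!case: (D (q j) _).
Qed.

Section Descent.

Variable l : nat.
Hypothesis l_gt0 : 1 <= l.
Hypothesis l_lt : l.+1 < k.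
Hypothesis al : D (q l) (q 0).
Hypothesis al1 : ~~ D (q l.+1) (q 0).

Let iz := interlaced_rotate crit iq l_gt0 l_lt al al1.
Local Notation z := (q l.+1).

Lemma rotate0 : rotate h q l 0 = q 0. Proof. by []. Qed.

Lemma rotate_lo i : l.+1 < i <= k.+1 -> rotate h q l (i - l.+1) = q i.
Proof.
move=> ik; rewrite /rotate ifF; last by lia.
by rewrite ifT; [congr q|]; lia.
Qed.

Lemma rotate_hi i : 1 <= i <= l.+1 -> rotate h q l (i + (k - l)) = q i.
Proof. by move=> ik; rewrite /rotate !ifF; [congr q| |]; lia. Qed.

Lemma rotatev : rotate h q l k.+1 = z.
Proof. by rewrite -(rotate_hi (i := l.+1)); [congr rotate|]; lia. Qed.

(** [z] ends the rotated path and so is tight along it. The three cases are the steps below [l],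
    those above [l.+1], and the step from [q k.+1] to [q 1] where the rotated path wraps around. *)
Lemma mid_lo i : 1 <= i < l -> D z (q i.+1) = ~~ D (q i) z.
Proof.
move=> il; have := tightv crit iz (i := i + (k - l)).
rewrite rotatev -addSn !rotate_hi; [|lia..].
by apply; lia.
Qed.

Lemma mid_hi i : l.+1 < i <= k -> D z (q i.+1) = ~~ D (q i) z.
Proof.
move=> il; have := tightv crit iz (i := i - l.+1).
rewrite rotatev -subSn; last by lia.
by rewrite !rotate_lo; [apply; lia|lia..].
Qed.

Lemma mid_1 : D z (q 1) = ~~ D (q k.+1) z.
Proof.
have := tightv crit iz (i := k - l).
have e : k.+1 - l.+1 = k - l by lia.
have e1 : (k - l).+1 = 1 + (k - l) by lia.
by rewrite rotatev e1 rotate_hi // -e rotate_lo; [apply; lia | lia].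
Qed.

Lemma mid_degree : degree D z = k.+1.
Proof. by rewrite -rotatev degreev. Qed.

(* If [q l] and [q l.+1] are both missing from the in-neighbours of [q k.+1], then
   [z] has the in-neighbours of [q k.+1] and two more, which exceeds [h.+1]. *)
Lemma descent_below :
  ~~ D (q l) (q k.+1) -> D (q l.+1) (q k.+1).
Proof.
move=> cl; apply: contraT => cl1; exfalso.
have vz : D (q k.+1) z by rewrite (tightv crit iq) ?cl //; lia.
have zv : D z (q k.+1) = false by apply: negPf.
have kz : D (q k) z.
  by move: zv; rewrite mid_hi; [move=> /negbFE|lia].
have lz := path_arc iq (i := l) ltac:(lia).
have le i : 0 <= i < k + 2 ->
    D (q i) (q k.+1) + ((i == l) + (i == k.+1)) <= D (q i) z.
  move=> ik; have [->|il] := eqVneq i l.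
    by rewrite (negPf cl) lz (_ : (l == k.+1) = false) //; lia.
  have [->|iv] := eqVneq i k.+1; first by rewrite D_loopless vz.
  have [->|ik'] := eqVneq i k; first by rewrite kz (arc_kv iq).
  have [->|i0] := eqVneq i 0; first by rewrite (ends_nonadj crit iq).
  have [->|ill] := eqVneq i l.+1; first by rewrite zv.
  rewrite addn0; case ci: (D (q i) (q k.+1)) => //.
  case iz0: (D (q i) z) => //=; exfalso.
  have [il'|il'] := ltnP i l.
    have zi : D z (q i.+1) by rewrite mid_lo ?iz0 //; lia.
    close_cycle [:: (l.+1, l.+1); (i.+1, l); (0, 0); (1, i); (k.+1, k.+1); (l.+2, k)].
    by rewrite /= zi al (arc_01 iq) ci kz (tightv crit iq) ?cl1 //; lia.
  have zi : D z (q i.+1) by rewrite mid_hi ?iz0 //; lia.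
  have := forward0 crit iq (i := l.+1) (j := i.+1) isT _ zi ci.
  by rewrite (negPf al1) => f; suff: false by []; apply: f; lia.
have := sum_nat_le le; rewrite !big_split /= -(indegE iq) -(indegE iq).
rewrite !sum_nat_pred1; [|lia..].
have := dense_indeg crit (q k.+1); have := dense_outdeg crit z.
by have := mid_degree; rewrite /degree; lia.
Qed.

(** Dual count: otherwise [z] has all out-neighbours of [q k.+1] and, in addition, [q l.+2] and
    [q k.+1]. Its out-degree is then at least [h + 2], too much for degree [k + 1] and in-degree at
    least [h]. *)
Lemma descent_above :
  D (q l.+1) (q k.+1) -> ~~ D (q l) (q k.+1).
Proof.
move=> cl1; apply/negP => cl.
have vz : D (q k.+1) z = false by rewrite (tightv crit iq) ?cl //; lia.
have z1 : D z (q 1) by rewrite mid_1 vz.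
have zl := path_arc iq (i := l.+1) ltac:(lia).
have le i : 0 <= i < k + 2 ->
    D (q k.+1) (q i) + ((i == l.+2) + (i == k.+1)) <= D z (q i).
  move=> ik; have [->|il] := eqVneq i l.+2.
    have -> : (l.+2 == k.+1) = false by lia.
    by rewrite zl (tightv crit iq) ?cl1 //; lia.
  have [->|iv] := eqVneq i k.+1; first by rewrite D_loopless cl1.
  have [->|i1] := eqVneq i 1; first by rewrite z1 addn0 leq_b1.
  have [->|i0] := eqVneq i 0; first by rewrite (ends_nonadj crit iq).
  have [->|ill] := eqVneq i l.+1; first by rewrite vz.
  rewrite addn0; case: i ik il iv i1 i0 ill => [|i] // ik il iv i1 i0 ill.
  rewrite (tightv crit iq); last by lia.
  case ci: (D (q i) (q k.+1)) => //.
  case iz0: (D z (q i.+1)) => //=; exfalso.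
  have [il'|il'] := ltnP i l.
    have zi : D (q i) z by move: iz0; rewrite mid_lo; [move/negbFE|lia].
    have := forwardv crit iq (i := i) (j := l.+1) _ _ zi al.
    by rewrite ci => f; suff: false by []; apply: f; lia.
  have zi : D (q i) z by move: iz0; rewrite mid_hi; [move/negbFE|lia].
  close_cycle [:: (1, l); (k.+1, k.+1); (i.+1, k); (0, 0); (l.+2, i); (l.+1, l.+1)].
  by rewrite /= cl (tightv crit iq) ?ci ?(arc_k0 iq) ?(tight0 crit iq) ?al1 ?zi ?z1 //; lia.
have := sum_nat_le le; rewrite !big_split /= -(outdegE iq) -(outdegE iq).
rewrite !sum_nat_pred1; [|lia..].
have := dense_outdeg crit (q k.+1); have := dense_indeg crit z.
by have := mid_degree; rewrite /degree; lia.
Qed.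

(** At a common drop both ends are dominated by [q l] and dominate [q l.+2]. A position [i] where
    the two words differ then yields a Hamiltonian cycle, one of four according to the end that
    [q i] dominates and to the side of [l] on which it lies. *)
Lemma descent_twin :
  D (q l) (q k.+1) -> ~~ D (q l.+1) (q k.+1) -> twin_ends q.
Proof.
move=> cl cl1.
have zv : D z (q k.+1) = false by apply: negPf.
have vz : D (q k.+1) z = false by rewrite (tightv crit iq) ?cl //; lia.
have z1 : D z (q 1) by rewrite mid_1 vz.
have kz : D (q k) z.
  by move: zv; rewrite mid_hi; [move=> /negbFE|lia].
move=> i ik.
have [->|il] := eqVneq i l; first by rewrite al cl.
have [->|ill] := eqVneq i l.+1; first by rewrite zv (negPf al1).
have y_i := tight0 crit iq ik; have v_i := tightv crit iq ik.
have y_l : D (q 0) (q l.+2) by rewrite (tight0 crit iq) ?al1 //; lia.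
have v_l : D (q k.+1) (q l.+2) by rewrite (tightv crit iq) ?cl1 //; lia.
have [k0 kv] : D (q k) (q 0) /\ D (q k) (q k.+1).
  by split; [exact: (arc_k0 iq) | exact: (arc_kv iq)].
have [y1 v1] : D (q 0) (q 1) /\ D (q k.+1) (q 1).
  by split; [exact: (arc_01 iq) | exact: (arc_v1 iq)].
case ai: (D (q i) (q 0)) y_i => y_i; case ci: (D (q i) (q k.+1)) v_i => v_i //;
  exfalso; have [il'|il'] := ltnP i l.
- close_cycle [:: (1, i); (0, 0); (l.+2, k); (k.+1, k.+1); (i.+1, l.+1)];
  by rewrite /= ai y_l kv v_i z1.
- close_cycle [:: (1, l); (k.+1, k.+1); (i.+1, k); (l.+1, i); (0, 0)];
  by rewrite /= cl v_i kz ai y1.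
- close_cycle [:: (1, i); (k.+1, k.+1); (l.+2, k); (0, 0); (i.+1, l.+1)];
  by rewrite /= ci v_l k0 y_i z1.
close_cycle [:: (1, l); (0, 0); (i.+1, k); (l.+1, i); (k.+1, k.+1)].
by rewrite /= al y_i kz ci v1.
Qed.

End Descent.
End Path.
End NonTwins.

(** * Ends with complementary in-neighbourhoods *)

Lemma sum_nat_pred1b (m n i : nat) (b : bool) :
  m <= i < n -> \sum_(m <= j < n) ((j == i) && b) = b.
Proof.
move=> imn; case: b; last by rewrite big1 // => j _; rewrite andbF.
by rewrite -[RHS](sum_nat_pred1 imn); apply: eq_bigr => j _; rewrite andbT.
Qed.

Section Complement.

Variables (V : finType) (D : rel V) (h : nat).
Hypothesis crit : nonham_dense h D.

Let D_loopless := dense_loopless crit.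
Let h_ge2 := dense_order crit.

Local Notation k := (2 * h).

Definition complementary (q : nat -> V) :=
  forall i, 1 <= i < k -> D (q i) (q k.+1) = ~~ D (q i) (q 0).

Lemma complementary_swap q :
  complementary q -> complementary (swap_ends h q).
Proof.
move=> co i ik; rewrite !swap_endsE swap_ends_mid; last by lia.
by rewrite co ?negbK.
Qed.

(** Upward induction shows that every position dominates some end: a first failure would be at
    position 1 or at a drop excluded by the descent lemmas. Downward induction shows that none
    dominates both: a last failure would be at [k - 1], or a drop of one word where the other stays
    1. *)
Lemma nontwin_complementary q :
  interlaced D h q -> ~ twin_ends D h q -> complementary q.
Proof.
move=> iq nt; have iq' := interlaced_swap crit iq.
have nt' : ~ twin_ends D h (swap_ends h q) by move=> tw; apply: nt; apply: twin_swap tw.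
have low i : 1 <= i < k -> D (q i) (q 0) || D (q i) (q k.+1).
  elim: i => [|[|i] IH] // ik; apply: contraT; rewrite negb_or => /andP[a1 c1].
    by case: nt; apply: (twin_first crit iq).
  have [a0|a0] := boolP (D (q i.+1) (q 0)).
    have [c0|c0] := boolP (D (q i.+1) (q k.+1)).
      by case: nt; apply: (descent_twin crit iq (l := i.+1)) => //; lia.
    have := descent_below crit iq (l := i.+1) isT _ a0 a1 c0.
    by rewrite (negPf c1); apply; lia.
  have c0 : D (q i.+1) (q k.+1).
    by have := IH; rewrite (negPf a0) /=; apply; lia.
  have := descent_below crit iq' (l := i.+1) isT.
  rewrite !swap_endsE !swap_ends_mid; [|lia..].
  by rewrite (negPf a1); apply => //; lia.
have high d i : i + d = k.-1 -> 1 <= i -> ~~ (D (q i) (q 0) && D (q i) (q k.+1)).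
  elim: d i => [|d IH] i id i_gt0; apply/negP => /andP[a0 c0].
    by case: nt; apply: (twin_last crit iq); rewrite -id addn0.
  have := IH i.+1; rewrite addSnnS => /(_ id isT).
  have ik : i.+1 < k by lia.
  have := low i.+1; rewrite ik => /(_ isT).
  case a1: (D (q i.+1) (q 0)); case c1: (D (q i.+1) (q k.+1)) => // _ _.
    have := descent_above crit iq' (l := i) i_gt0 ik.
    rewrite !swap_endsE !swap_ends_mid; [|lia..].
    by rewrite c0 c1 a0 a1 => /(_ isT isT isT).
  have := descent_above crit iq (l := i) i_gt0 ik.
  by rewrite c0 c1 a0 a1 => /(_ isT isT isT).
move=> i ik; have := low i ik; have := @high (k.-1 - i) i.
have e : i + (k.-1 - i) = k.-1 by lia.
have i_gt0 : 0 < i by lia.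
rewrite e i_gt0 => /(_ erefl isT).
by case: (D (q i) (q 0)); case: (D (q i) (q k.+1)).
Qed.

(** * Neighbours of [q 1] when exactly the first [r] positions precede the first drop *)

Section FirstRun.

Variable q : nat -> V.
Hypothesis iq : interlaced D h q.
Hypothesis co : complementary q.
Hypothesis a1 : D (q 1) (q 0).
Hypothesis h_ge3 : 3 <= h.

Ltac arith :=
  repeat match goal with H : context [D] |- _ => clear H end;
  intros; simpl; lia.

Ltac close_cycle bl :=
  apply: (no_cycle crit iq (bl := bl)); [arith | | arith | arith].

Let k0 := arc_k0 iq.
Let kv := arc_kv iq.
Let y1 := arc_01 iq.
Let v1 := arc_v1 iq.

Variable r : nat.
Hypothesis r_gt0 : 1 <= r.
Hypothesis r_lt : r.+1 < k.
Hypothesis ones : forall i, 1 <= i <= r -> D (q i) (q 0).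
Hypothesis zero : ~~ D (q r.+1) (q 0).

Local Notation z := (q r.+1).

Lemma run_from_0 i : 1 <= i < k -> D (q 0) (q i.+1) = ~~ D (q i) (q 0).
Proof. exact: (tight0 crit iq). Qed.

Lemma run_from_v i : 1 <= i < k -> D (q k.+1) (q i.+1) = D (q i) (q 0).
Proof. by move=> ik; rewrite (tightv crit iq) // co // negbK. Qed.

Lemma run_to_v i : 1 <= i < k -> D (q i) (q k.+1) = ~~ D (q i) (q 0).
Proof. exact: co. Qed.

Lemma run_end : D (q r) (q 0). Proof. by apply: ones; lia. Qed.

Lemma run_z_v : D z (q k.+1). Proof. by rewrite run_to_v ?zero //; lia. Qed.
Lemma run_v_z : D (q k.+1) z. Proof. by rewrite run_from_v ?run_end //; lia. Qed.

(** Otherwise [q i -> z] by tightness of [z], and this chord together with [q r -> q 0] makes [q i]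
    dominate [q k.+1]. But [q i] dominates [q 0], and the ends are complementary. *)
Lemma run_z_low i : 1 <= i < r -> D z (q i.+1).
Proof.
move=> ir; rewrite (mid_lo crit iq r_gt0 r_lt run_end zero) //; apply/negP => iz.
have := forwardv crit iq (i := i) (j := r.+1) _ _ iz run_end.
rewrite run_to_v; last by lia.
rewrite ones; last by lia.
by move=> f; suff: false by []; apply: f; lia.
Qed.

Lemma run_high_z i : r.+1 < i < k -> ~~ D (q i) (q 0) -> D (q i) z.
Proof.
move=> ir ai; apply: contraT => iz.
have zi : D z (q i.+1) by rewrite (mid_hi crit iq r_gt0 r_lt run_end zero) //; lia.
have := forward0 crit iq (i := r.+1) (j := i.+1) isT _ zi.
rewrite run_to_v ?ai; last by lia.
by rewrite (negPf zero); apply => //; lia.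
Qed.

Lemma run_no_high_1 i : r < i < k -> D (q i) (q 1) = false.
Proof.
move=> ir; apply/negP => i1.
have [ai|ai] := boolP (D (q i) (q 0)).
  have ir1 : r.+1 != i by apply: contraTneq ai => <-.
  close_cycle [:: (1, r.+1); (k.+1, k.+1); (i.+1, k); (0, 0); (r.+2, i)].
  by rewrite /= run_z_v run_from_v ?ai ?k0 ?run_from_0 ?zero ?i1 //; lia.
close_cycle [:: (1, 1); (0, 0); (i.+1, k); (k.+1, k.+1); (2, i)].
by rewrite /= a1 run_from_0 ?ai ?kv ?run_from_v ?i1 //; lia.
Qed.

Lemma run_out1_zero j : 2 < j <= k -> D (q 1) (q j) -> ~~ D (q j.-1) (q 0).
Proof.
move=> jk j1; apply/negP => aj.
have := forwardv crit iq (i := 1) (j := j) isT _ j1 aj.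
rewrite run_to_v; last by lia.
by rewrite a1 => f; suff: false by []; apply: f; lia.
Qed.

(** For [r = 1] the out-neighbours of [q 1] are among [q 0, q 2, q 3] and its in-neighbours among
    [q 0, q k, q k.+1]. Degree 6 is below [2 * h + 1 >= 7]. *)
Lemma first_run_gt1 : 1 < r.
Proof.
rewrite ltn_neqAle r_gt0 andbT; apply/eqP => r1.
have out1 i : 0 <= i < k + 2 ->
    nat_of_bool (D (q 1) (q i)) <= (i == 0) + ((i == 2) + (i == 3)).
  move=> ik; case ei: (D (q 1) (q i)) => //.
  have [_|i0] := eqVneq i 0; first by [].
  have [_|i2] := eqVneq i 2; first by [].
  have [_|i3] := eqVneq i 3; first by [].
  exfalso; have [ii|i1] := eqVneq i 1; first by rewrite ii D_loopless in ei.
  have [iv|iv] := eqVneq i k.+1.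
    by move: ei; rewrite iv run_to_v ?a1 //; lia.
  have ai : ~~ D (q i.-1) (q 0) by apply: run_out1_zero => //; lia.
  have iz : D (q i.-1) z by apply: run_high_z => //; lia.
  close_cycle [:: (1, 1); (i, k); (0, 0); (3, i.-1); (2, 2); (k.+1, k.+1)].
  have y3 : D (q 0) (q 3).
    by have := run_from_0 (i := r.+1); rewrite zero -r1; apply; lia.
  by move: run_z_v iz; rewrite -r1 /= ei k0 y3 v1 => -> ->.
have in1 i : 0 <= i < k + 2 ->
    nat_of_bool (D (q i) (q 1)) <= (i == 0) + ((i == k) + (i == k.+1)).
  move=> ik; case ei: (D (q i) (q 1)) => //.
  have [_|i0] := eqVneq i 0; first by [].
  have [_|i2] := eqVneq i k; first by [].
  have [_|i3] := eqVneq i k.+1; first by rewrite addn1.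
  exfalso; have [ii|i1] := eqVneq i 1; first by rewrite ii D_loopless in ei.
  by move: ei; rewrite run_no_high_1 //; lia.
have := dense_degree crit (q 1); rewrite /degree (outdegE iq) (indegE iq).
have := sum_nat_le out1; have := sum_nat_le in1.
by rewrite !big_split /= !sum_nat_pred1; lia.
Qed.

Lemma run_no_1_next : D (q 1) (q r.+2) = false.
Proof.
apply/negP => e1; have r_gt1 := first_run_gt1.
close_cycle [:: (1, 1); (r.+2, k); (k.+1, k.+1); (r.+1, r.+1); (2, r); (0, 0)].
by rewrite /= e1 kv run_v_z run_z_low ?run_end ?y1 //; lia.
Qed.

Lemma run_no_both i j : 2 <= i <= r -> r.+2 < j <= k ->
  D (q i) (q 1) -> D (q 1) (q j) -> False.
Proof.
move=> ir jr i1 j1; have r_gt1 := first_run_gt1.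
have aj : ~~ D (q j.-1) (q 0) by apply: run_out1_zero => //; lia.
close_cycle [:: (1, 1); (j, k); (0, 0); (r.+2, j.-1); (k.+1, k.+1);
                (i.+1, r.+1); (2, i)].
by rewrite /= j1 k0 run_from_0 ?zero ?run_to_v ?aj ?run_from_v ?ones ?run_z_low ?i1 //; lia.
Qed.

Lemma run_out1_bound i : 0 <= i < k + 2 ->
  nat_of_bool (D (q 1) (q i)) <=
  (i == 0) + ((i == 2) + (r.+2 < i <= k) && D (q 1) (q i)).
Proof.
move=> ik; case ei: (D (q 1) (q i)) => //.
have [_|i0] := eqVneq i 0; first by [].
have [_|i2] := eqVneq i 2; first by [].
rewrite andbT add0n lt0b; apply: contraT => ir; exfalso.
have [ii|i1] := eqVneq i 1; first by rewrite ii D_loopless in ei.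
have [iv|iv] := eqVneq i k.+1.
  by move: ei; rewrite iv run_to_v ?a1 //; lia.
have [ir2|ir2] := eqVneq i r.+2; first by rewrite ir2 run_no_1_next in ei.
have := run_out1_zero _ ei; rewrite ones; last by lia.
by move=> f; suff: false by []; apply: f; lia.
Qed.

(** [q 0] and [q 2] alone do not make out-degree [h >= 3], so [q 1] dominates some [q j] with
    [j > r + 2]. Then no [q i] with [2 <= i <= r] dominates [q 1]; its in-neighbours are among
    [q 0, q k, q k.+1], and [h = 3]. Degree 7 now needs four out-neighbours, and only
    [q 0, q 2, q 5, q 6] are possible, [q 5] only for [r = 2]. *)
Lemma first_run_small : [/\ h = 3, r = 2, D (q 1) (q 5), D (q 1) (q 6) & D (q 6) (q 1)].
Proof.
have r_gt1 := first_run_gt1.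
have [j jr j1] : exists2 j, r.+2 < j <= k & D (q 1) (q j).
  have [/existsP[j /andP[jr j1]]|none] :=
      boolP [exists j : 'I_k.+1, (r.+2 < j <= k) && D (q 1) (q j)].
    by exists j.
  have out1 i : 0 <= i < k + 2 ->
      nat_of_bool (D (q 1) (q i)) <= (i == 0) + (i == 2).
    move=> ik; apply: leq_trans (run_out1_bound ik) _; rewrite addnA -[leqRHS]addn0.
    rewrite leq_add2l leqn0 eqb0; apply: contra none => /andP[ir i1].
    have ik' : i < k.+1 by lia.
    by apply/existsP; exists (Ordinal ik'); rewrite /= ir.
  have := dense_outdeg crit (q 1); rewrite (outdegE iq).
  by have := sum_nat_le out1; rewrite !big_split /= !sum_nat_pred1; lia.
have in1 i : 0 <= i < k + 2 ->
    nat_of_bool (D (q i) (q 1)) <= (i == 0) + ((i == k.+1) + ((i == k) && D (q k) (q 1))).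
  move=> ik; case ei: (D (q i) (q 1)) => //.
  have [_|i0] := eqVneq i 0; first by [].
  have [_|i3] := eqVneq i k.+1; first by [].
  have [ii|i2] := eqVneq i k; first by rewrite -ii ei.
  exfalso; have [ii|i1] := eqVneq i 1; first by rewrite ii D_loopless in ei.
  have [ir|ir] := leqP i r; first by apply: (run_no_both (i := i)) jr ei j1; lia.
  by move: ei; rewrite run_no_high_1 //; lia.
have := sum_nat_le in1; have := dense_indeg crit (q 1).
have := dense_degree crit (q 1); rewrite /degree (indegE iq).
rewrite !big_split /= sum_nat_pred1; last by lia.
rewrite !sum_nat_pred1 ?sum_nat_pred1b; [|lia..].
move=> deg ind le_in.
have h3 : h = 3 by move: le_in; case: (D _ _); lia.
have k1 : D (q k) (q 1) by move: le_in; case: (D _ _) => //; lia.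
have out1 i : 0 <= i < k + 2 -> nat_of_bool (D (q 1) (q i)) <=
    (i == 0) + ((i == 2) + (((i == 5) && ((r == 2) && D (q 1) (q 5))) +
      ((i == 6) && D (q 1) (q 6)))).
  move=> ik; apply: leq_trans (run_out1_bound ik) _; rewrite !leq_add2l.
  case i1: (D (q 1) (q i)); last by rewrite andbF.
  rewrite andbT; case: (boolP (r.+2 < i <= k)) => // ri.
  have [i5|i5] := eqVneq i 5.
    have d5 : D (q 1) (q 5) by rewrite -i5.
    have r2 : r == 2 by lia.
    by rewrite d5 r2.
  have [i6|i6] := eqVneq i 6.
    have d6 : D (q 1) (q 6) by rewrite -i6.
    by rewrite d6 addn1.
  by exfalso; lia.
have := sum_nat_le out1; rewrite -(outdegE iq).
rewrite !big_split /= !sum_nat_pred1 ?sum_nat_pred1b; [|lia..].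
have e6 : k = 6 by lia.
rewrite -e6 k1 e6; case: eqP => [->|_] /=; case: (D (q 1) (q 6));
  case: (D (q 1) (q 5)) => // le_out; exfalso; lia.
Qed.

End FirstRun.
End Complement.

(** The vertex [q 6] has too few neighbours: Hamiltonian cycles and the chord lemmas leave it the
    out-neighbours [q 0, q 1, q 7] and the in-neighbours [q 0, q 1, q 5], hence degree at most 6
    instead of 7. *)
Lemma no_complementary8 (V : finType) (D : rel V) (q : nat -> V) :
  nonham_dense 3 D -> interlaced D 3 q -> complementary D 3 q ->
  D (q 1) (q 0) -> D (q 2) (q 0) -> ~~ D (q 3) (q 0) ->
  D (q 1) (q 5) -> D (q 1) (q 6) -> False.
Proof.
move=> crit iq co a1 a2 a3 e15 e16.
have six : 2 * 3 = 6 by [].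
have v_in i : 1 <= i < 6 -> D (q i) (q 7) = ~~ D (q i) (q 0).
  by move=> ik; rewrite -(co i ik).
have y_out i : 1 <= i < 6 -> D (q 0) (q i.+1) = ~~ D (q i) (q 0).
  by move=> ik; rewrite -(tight0 crit iq).
have v_out i : 1 <= i < 6 -> D (q 7) (q i.+1) = D (q i) (q 0).
  by move=> ik; have := tightv crit iq ik; rewrite [2 * 3]six => ->; rewrite v_in ?negbK.
have fwd0 i j : 1 <= i -> i.+1 < j <= 6 -> D (q i) (q j) ->
    D (q j.-1) (q 7) -> D (q i) (q 0) := forward0 crit iq (i := i) (j := j).
have fwdv i j : 1 <= i -> i.+1 < j <= 6 -> D (q i) (q j) ->
    D (q j.-1) (q 0) -> D (q i) (q 7) := forwardv crit iq (i := i) (j := j).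
have a4 : ~~ D (q 4) (q 0).
  by apply: contraL a1 => a4; have := fwdv 1 5 isT isT e15 a4; rewrite v_in.
have a5 : ~~ D (q 5) (q 0).
  by apply: contraL a1 => a5; have := fwdv 1 6 isT isT e16 a5; rewrite v_in.
have p i : i <= 6 -> D (q i) (q i.+1) := path_arc iq (i := i).
have k0 : D (q 6) (q 0) := arc_k0 iq.
have v1 : D (q 7) (q 1) := arc_v1 iq.
have z_hi i : 3 < i <= 6 -> D (q 3) (q i.+1) = ~~ D (q i) (q 3) :=
  mid_hi crit iq (l := 2) isT isT a2 a3 (i := i).
have e53 : D (q 5) (q 3).
  apply: contraT => e53; have e36 : D (q 3) (q 6) by rewrite z_hi.
  by have := fwd0 3 6 isT isT e36; rewrite v_in // a5 (negPf a3) => /(_ isT).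
have e3v : D (q 3) (q 7) by rewrite v_in.
have no bl := no_cycle crit iq (bl := bl).
have cov (bl : seq (nat * nat)) :
    all (fun x => has (fun b => b.1 <= x <= b.2) bl) (iota 0 8) ->
    forall x, x < 8 -> has (fun b : nat * nat => b.1 <= x <= b.2) bl.
  by move=> /allP h x x8; apply: h; rewrite mem_iota.
have y4 : D (q 0) (q 4) by rewrite y_out.
have y6 : D (q 0) (q 6) by rewrite y_out.
have v2 : D (q 7) (q 2) by rewrite v_out.
have e4v : D (q 4) (q 7) by rewrite v_in.
have e5v : D (q 5) (q 7) by rewrite v_in.
have y1 : D (q 0) (q 1) := p 0 isT.
have e12 : D (q 1) (q 2) := p 1 isT.
have e23 : D (q 2) (q 3) := p 2 isT.
have out6 i : 0 <= i < 8 -> nat_of_bool (D (q 6) (q i)) <=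
    (i == 0) + ((i == 1) + (i == 7)).
  case: i => [|[|[|[|[|[|[|[|i]]]]]]]] // _ /=; rewrite ?leq_b1 //;
    rewrite ?(dense_loopless crit) // leqn0 eqb0; apply/negP => e.
  - by apply: (no [:: (1, 1); (0, 0); (6, 6); (2, 5); (7, 7)]);
      [| rewrite /= a1 y6 e e5v v1 | | exact: cov].
  - by apply: (no [:: (1, 2); (0, 0); (6, 6); (3, 5); (7, 7)]);
      [| rewrite /= a2 y6 e e5v v1 | | exact: cov].
  - by apply: (no [:: (1, 1); (6, 6); (4, 5); (3, 3); (7, 7); (2, 2); (0, 0)]);
      [| rewrite /= e16 e e53 e3v v2 a2 y1 | | exact: cov].
  by apply: (no [:: (1, 1); (6, 6); (5, 5); (3, 4); (7, 7); (2, 2); (0, 0)]);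
    [| rewrite /= e16 e e53 e4v v2 a2 y1 | | exact: cov].
have in6 i : 0 <= i < 8 -> nat_of_bool (D (q i) (q 6)) <=
    (i == 0) + ((i == 1) + (i == 5)).
  case: i => [|[|[|[|[|[|[|[|i]]]]]]]] // _ /=; rewrite ?leq_b1 //;
    rewrite ?(dense_loopless crit) // leqn0 eqb0; apply/negP => e.
  - by apply: (no [:: (2, 2); (6, 6); (0, 0); (4, 5); (3, 3); (7, 7); (1, 1)]);
      [| rewrite /= e k0 y4 e53 e3v v1 e12 | | exact: cov].
  - by have := fwd0 3 6 isT isT e e5v; rewrite (negPf a3).
  - by have := fwd0 4 6 isT isT e e5v; rewrite (negPf a4).
  by move: e; rewrite v_out // (negPf a5).
have := dense_degree crit (q 6); rewrite /degree.
have := sum_nat_le out6; have := sum_nat_le in6.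
rewrite -!(outdegE iq) -!(indegE iq) !big_split !sum_nat_pred1 //.
by move: (outdeg _ _) (indeg _ _) => a b /=; clear; lia.
Qed.

Section Complementary.

Variables (V : finType) (D : rel V) (h : nat).
Hypothesis crit : nonham_dense h D.

Lemma complementary_order q :
  interlaced D h q -> complementary D h q -> h = 2.
Proof.
move=> iq co; have h_ge2 := dense_order crit.
apply/eqP; apply: contraT => h_neq2; have h_ge3 : 3 <= h by lia.
(* By complementarity [q 1] dominates exactly one end, and the ends may be swapped. *)
wlog a1 : q iq co / D (q 1) (q 0).
  move=> IH; case a1: (D (q 1) (q 0)); first exact: (IH q).
  apply: (IH (swap_ends h q)).
  - exact: (interlaced_swap crit).
  - exact: (complementary_swap crit).
  by rewrite swap_endsE swap_ends_mid ?co ?a1; lia.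
have [m mP m_min] : {m | (1 <= m < 2 * h) && ~~ D (q m) (q 0) &
    forall i, (1 <= i < 2 * h) && ~~ D (q i) (q 0) -> m <= i}.
  have ex : exists m, (1 <= m < 2 * h) && ~~ D (q m) (q 0).
    have [/existsP[m mP]|none] :=
      boolP [exists m : 'I_(2 * h), (1 <= m < 2 * h) && ~~ D (q m) (q 0)].
      by exists m.
    have := dense_outdeg crit (q 0); rewrite (outdeg0 crit iq).
    rewrite big_nat big1 => [|i ik]; first by lia.
    case a: (D (q i) (q 0)) => //; case/existsP: none.
    have ik' : i < 2 * h by lia.
    by exists (Ordinal ik'); rewrite /= ik a.
  by case: (ex_minnP ex) => m; exists m.
have [r er] : {r | m = r.+1} by exists m.-1; lia.
case/andP: mP => mk am.
have r_gt0 : 1 <= r by rewrite lt0n; apply: contraNneq am => r0; rewrite er r0.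
have ones i : 1 <= i <= r -> D (q i) (q 0).
  move=> ir; apply: contraT => ai; suff: m <= i by lia.
  by apply: m_min; rewrite ai; lia.
rewrite er in am; have r_lt : r.+1 < 2 * h by lia.
have [h3 r2 e5 e6 _] := first_run_small crit iq co a1 h_ge3 r_gt0 r_lt ones am.
move: (crit) (iq) (co) am; rewrite h3 r2 => crit3 iq3 co3 a3; exfalso.
by apply: (no_complementary8 crit3 iq3 co3 a1 (ones 2 _) a3 e5 e6); rewrite r2.
Qed.

End Complementary.

(** * Ends that are twins *)

Lemma in_Hnn11_converse n (V : finType) (D : rel V) :
  in_Hnn11 n (converse D) -> in_Hnn11 n D.
Proof.
case=> A [B [a [part card indep [AB BA] atA]]]; exists A, B, a; split=> //.
- by move=> x y xA yA; apply: indep.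
- by split=> x y xX yY; [apply: BA | apply: AB].
case: atA => -[nbr dom]; [right | left]; split=> // x y xX yY; exact: dom.
Qed.

(* The pair [S], [T] violates Hall's condition for a cycle factor by one. *)
Lemma hall_in_Hnn11 n (V : finType) (D : rel V) (S T : {set V}) :
  irreflexive D -> #|V| = 2 * n ->
  (forall x, 2 * n - 1 <= degree D x) ->
  (forall x, n - 1 <= outdeg D x) -> (forall x, n - 1 <= indeg D x) ->
  no_arc D S T -> #|S| = n -> #|T| = n.+1 -> in_Hnn11 n D.
Proof.
move=> irr cardV deg out ind noST cardS cardT.
have cardCS : #|~: S| = n by have := cardsC S; rewrite cardV; lia.
have cardCT : #|~: T| = n - 1 by have := cardsC T; rewrite cardV; lia.
have outS s : s \in S -> out_nbr D s = ~: T.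
  move=> sS; apply/eqP; rewrite eqEcard cardCT out andbT.
  apply/subsetP => x; rewrite !inE; apply: contraL => xT; exact: noST.
have subST : S \subset T.
  apply/subsetP => s sS; have := outS s sS; move/setP/(_ s).
  by rewrite !inE irr => /esym/negbFE.
have inS s : s \in S -> in_nbr D s = ~: S.
  move=> sS; apply/eqP; rewrite eqEcard cardCS; apply/andP; split.
    apply/subsetP => x; rewrite !inE; apply: contraL => xS; apply: noST => //.
    exact: (subsetP subST).
  have := deg s; rewrite /degree {1}/outdeg outS // cardCT /indeg.
  by have := subset_leq_card subST; rewrite cardS cardT; lia.
have /cards1P[a eqa] : #|T :\: S| == 1.
  by rewrite cardsD (setIidPr subST) cardS cardT subSnn.
have /setDP[aT aS] : a \in T :\: S by rewrite eqa set11.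
have memT x : x \in T -> x \notin S -> x = a.
  by move=> xT xS; apply/set1P; rewrite -eqa inE xS.
exists S, (~: T), a; split.
- split.
  + apply/setP => x; rewrite !inE; case: (boolP (x \in S)) => //= xS.
    by case: (boolP (x \in T)) => //= xT; rewrite (memT x) ?eqxx.
  + by rewrite disjoints_subset setCK.
  + exact: aS.
  by rewrite inE negbK.
- split=> //; rewrite cardCT; have := max_card (mem T).
  by rewrite cardT cardV; clear; lia.
- by move=> x y xS yS; apply: noST => //; apply: (subsetP subST).
- split=> x y.
    by move=> xS yT; have := outS x xS; move/setP/(_ y); rewrite yT !inE.
  move=> xT yS; have := inS y yS; move/setP/(_ x); rewrite !inE => ->.
  by apply: contraTN xT => xS; rewrite inE negbK (subsetP subST).
left; split.
  apply/eqP; rewrite eqEcard cardCT ind andbT; apply/subsetP => x.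
  rewrite !inE => xa; apply/negP => xT.
  have xS : x \notin S by apply: contraL xa => xS; apply: noST.
  by move: xa; rewrite (memT x) // irr.
move=> x y; rewrite inE => /eqP -> yS.
by have := inS y yS; move/setP/(_ a); rewrite !inE => ->.
Qed.

Lemma descent_between (P : nat -> bool) i j : i < j -> P i -> ~~ P j ->
  exists2 l, i <= l < j & P l && ~~ P l.+1.
Proof.
move=> ij Pi; elim: j ij => // j IH; rewrite ltnS => ij PNj.
have [Pj|NPj] := boolP (P j); first by exists j; rewrite ?Pj //; lia.
have ij' : i < j by rewrite ltn_neqAle ij andbT; apply: contraNneq NPj => <-.
by have [l lP Pl] := IH ij' NPj; exists l => //; lia.
Qed.

Section Twins.

Variables (V : finType) (D : rel V) (h : nat).
Hypothesis crit : nonham_dense h D.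
Hypothesis cardV : #|V| = 2 * h + 2.

Let irr := dense_loopless crit.
Let h_ge2 := dense_order crit.

Local Notation k := (2 * h).

Variable q : nat -> V.
Hypothesis iq : interlaced D h q.
Hypothesis twq : twin_ends D h q.
Hypothesis tw_rotate : forall l, 1 <= l -> l.+1 < k ->
  D (q l) (q 0) -> ~~ D (q l.+1) (q 0) -> twin_ends D h (rotate h q l).

(** Let [q i -> q j] be such an arc, with [i] and [j] inner positions; then [q j.-1 -> q 0] by
    tightness. For [i < j] the chord contradicts [forward0]. Otherwise the word drops somewhere from
    [j - 1] to [i]. After rotation at that drop [q i] precedes [q j], and the same argument applies
    because the rotated ends are twins too; if [q i] or [q j] is itself the new end, twinness is
    contradicted directly. *)
Lemma twins_no_arc :
  no_arc D [set x | ~~ D x (q 0)] [set x | ~~ D (q 0) x].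
Proof.
case: (iq) => surj _ _ _ _ x w; rewrite !inE.
have [i iN ->] := surj x; have [j jN ->] := surj w => ai yj; apply/negP => ij.
have [i0|i0] := eqVneq i 0; first by rewrite -{1}i0 ij in yj.
have [j0|j0] := eqVneq j 0; first by rewrite -{1}j0 ij in ai.
have j1 : j != 1 by apply: contraNneq yj => ->; apply: arc_01 iq.
have [jv|jv] := eqVneq j k.+1.
  have [iv|iv] := eqVneq i k.+1; first by rewrite jv iv irr in ij.
  have ik : i != k by apply: contraNneq ai => ->; apply: arc_k0 iq.
  by move: ai; rewrite twq -?jv ?ij //; lia.
have jE : j = j.-1.+1 by lia.
have aj : D (q j.-1) (q 0).
  by move: yj; rewrite jE (tight0 crit iq) ?negbK //; lia.
have [iv|iv] := eqVneq i k.+1.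
  by move: ij; rewrite iv jE (tightv crit iq) -?twq ?aj //; lia.
have ik : i != k by apply: contraNneq ai => ->; apply: arc_k0 iq.
have [lt_ij|le_ji] := ltnP i j.
  have nij : i != j.-1 by apply: contraNneq ai => ->.
  have cj : D (q j.-1) (q k.+1) by rewrite -twq //; lia.
  by case/negP: ai; apply: (forward0 crit iq (i := i) (j := j)) => //; lia.
have [l lP /andP[al al1]] :=
  descent_between (P := fun i => D (q i) (q 0)) (i := j.-1) (j := i)
    ltac:(lia) aj ai.
have l_gt0 : 0 < l by lia.
have l_lt : l.+1 < k by lia.
have iz := interlaced_rotate crit iq l_gt0 l_lt al al1.
have tw := tw_rotate l_gt0 l_lt al al1.
have zv : rotate h q l k.+1 = q l.+1 := rotatev crit q l_gt0 l_lt.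
have lo a : l.+1 < a <= k.+1 -> rotate h q l (a - l.+1) = q a.
  exact: (rotate_lo crit q l_gt0 l_lt).
have hi a : 1 <= a <= l.+1 -> rotate h q l (a + (k - l)) = q a.
  exact: (rotate_hi crit q l_gt0 l_lt).
have tw_lo a : l.+1 < a <= k -> D (q a) (q 0) = D (q a) (q l.+1).
  move=> al'; have := tw (a - l.+1); rewrite zv lo ?rotate0; last by lia.
  by apply; lia.
have tw_hi a : 1 <= a < l -> D (q a) (q 0) = D (q a) (q l.+1).
  move=> al'; have := tw (a + (k - l)); rewrite zv hi ?rotate0; last by lia.
  by apply; lia.
have nij : i != j by apply: contraTneq ij => ->; rewrite irr.
have [il|il] := eqVneq i l.+1.
  move: ij; rewrite il jE (mid_lo crit iq l_gt0 l_lt al al1); last by lia.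
  by rewrite -tw_hi ?aj //; lia.
have [jl|jl] := eqVneq j l.+1.
  by move: ai; rewrite tw_lo -?jl ?ij //; lia.
have := forward0 crit iz (i := i - l.+1) (j := j + (k - l)).
rewrite rotate0 zv lo ?hi; [|lia..].
have -> : (j + (k - l)).-1 = j.-1 + (k - l) by lia.
rewrite hi; last by lia.
rewrite -tw_hi ?aj ?ij; last by lia.
by rewrite (negPf ai) => f; suff: false by []; apply: f; lia.
Qed.

(** The degree of [q 0] is exactly [2 * h + 1], so [S] and [T] have sizes [h + 1] and [h + 2] in one
    order or the other. If [S] is the larger set, the Hall argument is applied to the converse
    digraph. *)
Lemma twins_in_Hnn11 : in_Hnn11 h.+1 D.
Proof.
pose S := [set x | ~~ D x (q 0)]; pose T := [set x | ~~ D (q 0) x].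
have cardV' : #|V| = 2 * h.+1 by lia.
have cardS : #|S| + indeg D (q 0) = 2 * h.+1.
  rewrite -cardV' addnC -(cardsC (in_nbr D (q 0))) /indeg; congr (_ + #|pred_of_set _|).
  by apply/setP => x; rewrite !inE.
have cardT : #|T| + outdeg D (q 0) = 2 * h.+1.
  rewrite -cardV' addnC -(cardsC (out_nbr D (q 0))) /outdeg; congr (_ + #|pred_of_set _|).
  by apply/setP => x; rewrite !inE.
have deg := degree0 crit iq; rewrite /degree in deg.
have degC x : 2 * h.+1 - 1 <= degree D x.
  by apply: leq_trans (dense_degree crit x); lia.
have outC x : h.+1 - 1 <= outdeg D x by rewrite subSS subn0 (dense_outdeg crit).
have inC x : h.+1 - 1 <= indeg D x by rewrite subSS subn0 (dense_indeg crit).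
have [in_h|in_h] := eqVneq (indeg D (q 0)) h.+1.
  apply: (@hall_in_Hnn11 _ _ _ S T) => //; first exact: twins_no_arc.
    by lia.
  by lia.
apply: in_Hnn11_converse; have := dense_indeg crit (q 0).
have := dense_outdeg crit (q 0) => out_le in_le.
apply: (@hall_in_Hnn11 _ _ _ T S) => //.
- by move=> x; rewrite /degree addnC; apply: degC.
- by move=> x y xT yS; apply: twins_no_arc.
- by lia.
by lia.
Qed.

End Twins.

(** * Order six *)

Lemma diso_of_bij (V W : finType) (D : rel V) (E : rel W) (g : W -> V) :
  bijective g -> (forall i j, D (g i) (g j) = E i j) -> diso D E.
Proof.
case=> f gK fK DE; exists f; first by exists g.
by move=> x y; rewrite -DE !fK.
Qed.

(* Arcs of a digraph on the path positions [0, ..., 5] whose ends 0 and 5 have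
   complementary neighbourhoods and satisfy [1 -> 0]; the bits are the arcs
   from 2, 3 to 0 and the chords of the inner path [1, 2, 3, 4]. *)
Definition arcs6 (s : bitseq) (i j : nat) : bool :=
  let b := nth false s in
  match i, j with
  | 0, 1 => true | 0, 3 => ~~ b 0 | 0, 4 => ~~ b 1
  | 1, 0 => true | 1, 2 => true | 1, 3 => b 2 | 1, 4 => b 3
  | 2, 0 => b 0 | 2, 1 => b 4 | 2, 3 => true | 2, 4 => b 5 | 2, 5 => ~~ b 0
  | 3, 0 => b 1 | 3, 1 => b 6 | 3, 2 => b 7 | 3, 4 => true | 3, 5 => ~~ b 1
  | 4, 0 => true | 4, 1 => b 8 | 4, 2 => b 9 | 4, 3 => b 10 | 4, 5 => true
  | 5, 1 => true | 5, 2 => true | 5, 3 => b 0 | 5, 4 => b 1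
  | _, _ => false
  end.

Fixpoint bitseqs (n : nat) : seq bitseq :=
  if n is m.+1 then map (cons true) (bitseqs m) ++ map (cons false) (bitseqs m)
  else [:: [::]].

Lemma mem_bitseqs n s : (s \in bitseqs n) = (size s == n).
Proof.
elim: n s => [|n IH] [|b s] //=; rewrite mem_cat.
  by apply/negbTE/norP; split; apply/mapP => -[].
rewrite eqSS -IH; apply/orP/idP => [[] /mapP[t ts [_ ->]] //|ss].
by case: b; [left | right]; apply: map_f.
Qed.

(* Unlike [has] and [all], these stop at the first success or failure under
   call by value evaluation. *)
Fixpoint hasb (T : Type) (p : T -> bool) (s : seq T) : bool :=
  if s is x :: s' then if p x then true else hasb p s' else false.

Fixpoint allb (T : Type) (p : T -> bool) (s : seq T) : bool :=
  if s is x :: s' then if p x then allb p s' else false else true.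

Lemma hasbE (T : Type) (p : T -> bool) s : hasb p s = has p s.
Proof. by elim: s => //= x s ->. Qed.

Lemma allbE (T : Type) (p : T -> bool) s : allb p s = all p s.
Proof. by elim: s => //= x s ->. Qed.

Definition out6 (s : bitseq) i := count (arcs6 s i) (iota 0 6).
Definition in6 (s : bitseq) i := count (fun j => arcs6 s j i) (iota 0 6).

(** The thresholds are [h = 2] and [2 * h + 1 = 5]. *)
Definition sparse6 s := hasb (fun i =>
  [|| out6 s i < 2, in6 s i < 2 | out6 s i + in6 s i < 5]) (iota 0 6).

Fixpoint pathb (e : rel nat) x p :=
  if p is y :: p' then if e x y then pathb e y p' else false else e x 0.

Definition ham6 s := hasb (pathb (arcs6 s) 0) (permutations (iota 1 5)).

Definition iso6 (arcs : seq (nat * nat)) s :=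
  hasb (fun p => allb (fun i => allb (fun j =>
      arcs6 s (nth 0 p i) (nth 0 p j) == ((i, j) \in arcs)) (iota 0 6)) (iota 0 6))
    (permutations (iota 0 6)).

(** Exhaustive search over the [2 ^ 11] digraphs left open by tightness and complementarity;
    isomorphisms are sought among all relabellings of the six positions. *)
Lemma check6 : allb (fun s => if sparse6 s then true else if ham6 s then true else
  if iso6 D6_arcs s then true else iso6 ((2, 4) :: D6_arcs) s) (bitseqs 11).
Proof. by vm_compute. Qed.

Section Order6.

Variables (V : finType) (D : rel V).
Hypothesis crit : nonham_dense 2 D.

Section Position.

Variable q : nat -> V.
Hypothesis iq : interlaced D 2 q.
Hypothesis co : complementary D 2 q.
Hypothesis a1 : D (q 1) (q 0).

Let s := [:: D (q 2) (q 0); D (q 3) (q 0); D (q 1) (q 3); D (q 1) (q 4);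
  D (q 2) (q 1); D (q 2) (q 4); D (q 3) (q 1); D (q 3) (q 2);
  D (q 4) (q 1); D (q 4) (q 2); D (q 4) (q 3)].

Lemma arcs6E i j : i < 6 -> j < 6 -> D (q i) (q j) = arcs6 s i j.
Proof.
have irr := dense_loopless crit.
have t0 i' : 1 <= i' < 4 -> D (q 0) (q i'.+1) = ~~ D (q i') (q 0).
  exact: (tight0 crit iq).
have tv i' : 1 <= i' < 4 -> D (q 5) (q i'.+1) = ~~ D (q i') (q 5).
  exact: (tightv crit iq).
have cc i' : 1 <= i' < 4 -> D (q i') (q 5) = ~~ D (q i') (q 0) by apply: co.
have p i' : i' <= 4 -> D (q i') (q i'.+1) := path_arc iq (i := i').
have k0 : D (q 4) (q 0) := arc_k0 iq.
have v1 : D (q 5) (q 1) := arc_v1 iq.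
have [n1 n2] : D (q 0) (q 5) = false /\ D (q 5) (q 0) = false.
  by have [] := ends_nonadj crit iq.
case: i => [|[|[|[|[|[|i]]]]]] // _; case: j => [|[|[|[|[|[|j]]]]]] // _;
  by rewrite /= ?irr ?n1 ?n2 ?k0 ?v1 ?p ?t0 ?tv ?cc ?a1 ?negbK.
Qed.

Lemma out6E i : i < 6 -> outdeg D (q i) = out6 s i.
Proof.
move=> i6; rewrite (outdegE iq) /out6 -sumn_count sumnE big_map.
rewrite !big_seq; apply: eq_bigr => j; rewrite mem_iota => /andP[_ j6].
by rewrite arcs6E.
Qed.

Lemma in6E i : i < 6 -> indeg D (q i) = in6 s i.
Proof.
move=> i6; rewrite (indegE iq) /in6 -sumn_count sumnE big_map.
rewrite !big_seq; apply: eq_bigr => j; rewrite mem_iota => /andP[_ j6].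
by rewrite arcs6E.
Qed.

Lemma not_sparse6 : sparse6 s = false.
Proof.
apply/negbTE; rewrite /sparse6 hasbE; apply/hasPn => i; rewrite mem_iota.
move=> /andP[_ i6]; rewrite -out6E // -in6E //.
have := dense_outdeg crit (q i); have := dense_indeg crit (q i).
by have := dense_degree crit (q i); rewrite /degree; lia.
Qed.

Lemma path_pathb x p : x < 6 -> {subset p <= iota 0 6} ->
  pathb (arcs6 s) x p -> path D (q x) (rcons (map q p) (q 0)).
Proof.
elim: p x => [|y p IH] x x6 ps /=; first by rewrite arcs6E ?andbT.
have y6 : y < 6 by have := ps y; rewrite mem_head mem_iota => /(_ isT).
rewrite arcs6E //; case: ifP => // _ pp; apply: IH => // z zp.
by apply: ps; rewrite inE zp orbT.
Qed.

Lemma not_ham6 : ham6 s = false.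
Proof.
apply/negbTE; rewrite /ham6 hasbE; apply/hasPn => p; rewrite mem_permutations.
move=> pp; apply/negP => pathp; apply: (dense_nonham crit).
have mp x : (x \in p) = (0 < x < 6) by rewrite (perm_mem pp) mem_iota.
case: (iq) => surj inj _ _ _.
exists (map q (0 :: p)); split.
- by rewrite /= size_map (perm_size pp).
- rewrite /ucycle; apply/andP; split.
    rewrite /= path_pathb // => x; rewrite mp mem_iota.
    by move=> /andP[].
  rewrite map_inj_in_uniq ?cons_uniq ?mp ?(perm_uniq pp) // => i j.
  rewrite !inE !mp => ip jp; apply: inj; lia.
move=> x; have [i i6 ->] := surj x; apply: map_f; rewrite inE mp; lia.
Qed.

Lemma iso6P arcs : iso6 arcs s ->
  diso D (fun i j : 'I_6 => (val i, val j) \in arcs).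
Proof.
rewrite /iso6 hasbE => /hasP[p]; rewrite mem_permutations => pp.
rewrite allbE => /allP arcsP; case: (iq) => surj inj _ _ _.
have size_p : size p = 6 by rewrite (perm_size pp) size_iota.
have nth6 (i : nat) : i < 6 -> nth 0 p i < 6.
  move=> i6; have : nth 0 p i \in p by apply: mem_nth; rewrite size_p.
  by rewrite (perm_mem pp) mem_iota.
apply: (@diso_of_bij _ _ _ _ (fun i : 'I_6 => q (nth 0 p i))).
  apply: inj_card_bij => [i j|].
    move=> /inj; rewrite !nth6 // => /(_ isT isT) /eqP.
    by rewrite nth_uniq ?size_p // ?(perm_uniq pp) ?iota_uniq // => /eqP/val_inj.
  have <- : size (map q (iota 0 6)) = #|V|.
    by rewrite (perm_size (perm_enum_index surj inj)) -cardE.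
  by rewrite card_ord.
move=> i j; rewrite arcs6E ?nth6 //.
have := arcsP (val i); rewrite mem_iota ltn_ord => /(_ isT).
rewrite allbE => /allP/(_ (val j)); rewrite mem_iota ltn_ord => /(_ isT).
by move/eqP.
Qed.

Lemma order6_iso_first : diso D D6 \/ diso D D6'.
Proof.
have := check6; rewrite allbE => /allP/(_ s).
rewrite mem_bitseqs => /(_ isT); rewrite not_sparse6 not_ham6.
by case: ifP => [/iso6P|_ /iso6P]; [left | right].
Qed.

End Position.

Lemma order6_iso q :
  interlaced D 2 q -> complementary D 2 q -> diso D D6 \/ diso D D6'.
Proof.
move=> iq co; have [a1|a1] := boolP (D (q 1) (q 0)).
  exact: order6_iso_first a1.
apply: (order6_iso_first (interlaced_swap crit iq)).
  exact: (complementary_swap crit).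
by rewrite swap_endsE swap_ends_mid // co.
Qed.

End Order6.

Lemma nontwin_iso (V : finType) (D : rel V) h q :
  nonham_dense h D -> interlaced D h q -> ~ twin_ends D h q ->
  diso D D6 \/ diso D D6'.
Proof.
move=> crit iq /(nontwin_complementary crit iq) co.
have h2 := complementary_order crit iq co.
by move: crit iq co; rewrite h2 => crit iq co; apply: (order6_iso crit iq co).
Qed.

(** A boolean form, so that twinness of all rotations together can be decided by a case split. *)
Definition twinb (V : finType) (D : rel V) h (q : nat -> V) : bool :=
  [forall i : 'I_(2 * h), (0 < i) ==> (D (q i) (q 0) == D (q i) (q (2 * h).+1))].

Lemma twin_endsP (V : finType) (D : rel V) h q :
  reflect (twin_ends D h q) (twinb D h q).
Proof.
apply: (iffP forallP) => [tw i /andP[i0 ik]|tw i].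
  by have := tw (Ordinal ik); rewrite i0 /= => /eqP.
by apply/implyP => i0; rewrite tw // i0 ltn_ord.
Qed.

Lemma interlaced_conclusion (V : finType) (D : rel V) h q :
  nonham_dense h D -> #|V| = 2 * h + 2 -> interlaced D h q ->
  in_Hnn11 h.+1 D \/ (diso D D6 \/ diso D D6').
Proof.
move=> crit cardV iq.
case: (boolP (twinb D h q)) => [/twin_endsP tw|/twin_endsP nt]; last first.
  by right; apply: nontwin_iso nt.
case: (boolP [forall l : 'I_(2 * h),
    [&& 1 <= l, l.+1 < 2 * h, D (q l) (q 0) & ~~ D (q l.+1) (q 0)] ==>
    twinb D h (rotate h q l)]) => [/forallP all_tw|].
  left; apply: (twins_in_Hnn11 crit cardV iq) => // l l0 lk al al1.
  apply/twin_endsP.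
  by have := all_tw (Ordinal (ltnW lk)); rewrite /= l0 lk al al1.
rewrite negb_forall => /existsP[l]; rewrite negb_imply.
move=> /andP[/and4P[l0 lk al al1] /twin_endsP nt].
by right; apply: (nontwin_iso crit (interlaced_rotate crit iq l0 lk al al1) nt).
Qed.

(** * Digraphs that are not strong *)

Lemma complete_diso (V : finType) (D : rel V) n (S : {set V}) :
  #|S| = n -> {in S &, forall x y, D x y = (x != y)} ->
  diso (induced D S) (complete_digraph n).
Proof.
move=> cardS complS; have e : n = #|{: {x : V | x \in S}}| by rewrite card_sig -cardS.
apply: (@diso_of_bij _ _ _ _ (fun i => enum_val (cast_ord e i))).
  by apply: bij_comp; [apply: enum_val_bij |
    exists (cast_ord (esym e)) => i; rewrite ?cast_ordK ?cast_ordKV].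
move=> i j; rewrite /induced complS.
  rewrite /complete_digraph (inj_eq val_inj) (inj_eq enum_val_inj).
  by rewrite (inj_eq (@cast_ord_inj _ _ _)).
all: exact: (valP (enum_val (cast_ord e _))).
Qed.

Section Closed.

Variables (n : nat) (V : finType) (D : rel V).
Hypothesis irr : irreflexive D.
Hypothesis n_gt0 : 0 < n.
Hypothesis cardV : #|V| = 2 * n.
Hypothesis deg : forall x, 2 * n - 1 <= degree D x.
Hypothesis out : forall x, n - 1 <= outdeg D x.
Hypothesis ind : forall x, n - 1 <= indeg D x.

(** Vertices of [B] have their out-neighbours in [B], the others have their in-neighbours outside,
    so each part has at least [n] vertices and thus exactly [n]. The semi-degree bounds then make
    both parts complete, and degree [2 * n - 1] gives every vertex an arc across. *)
Lemma closed_in_Hnn (B : {set V}) :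
  B != set0 -> B != setT -> no_arc D B (~: B) -> in_Hnn n D.
Proof.
move=> B0 BT noB.
have sub_out x : x \in B -> out_nbr D x \subset B :\ x.
  move=> xB; apply/subsetP => y; rewrite !inE => xy; apply/andP; split.
    by apply: contraTneq xy => ->; rewrite irr.
  by apply: contraLR xy => yB; apply: noB; rewrite ?inE.
have sub_in x : x \notin B -> in_nbr D x \subset ~: B :\ x.
  move=> xB; apply/subsetP => y; rewrite !inE => xy; apply/andP; split.
    by apply: contraTneq xy => ->; rewrite irr.
  by apply: contraL xy => yB; apply: noB; rewrite ?inE.
have cB x : x \in B -> #|B| = #|B :\ x|.+1 by move=> xB; rewrite (cardsD1 x B) xB.
have cCB x : x \notin B -> #|~: B| = #|~: B :\ x|.+1.
  by move=> xB; rewrite (cardsD1 x (~: B)) inE xB.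
have [b bB] := set0Pn _ B0.
have [a aB] : exists a, a \notin B.
  apply/existsP; apply: contraR BT; rewrite negb_exists => /forallP nB.
  by apply/eqP/setP => x; rewrite inE; apply/negPn.
have leB : n <= #|B|.
  have := subset_leq_card (sub_out b bB); have := out b.
  by rewrite /outdeg (cB b bB); lia.
have leCB : n <= #|~: B|.
  have := subset_leq_card (sub_in a aB); have := ind a.
  by rewrite /indeg (cCB a aB); lia.
have [eB eCB] : #|B| = n /\ #|~: B| = n by have := cardsC B; lia.
have outB x : x \in B -> out_nbr D x = B :\ x.
  move=> xB; apply/eqP; rewrite eqEcard sub_out //.
  by have := out x; have := cB x xB; rewrite /outdeg eB; lia.
have inCB x : x \notin B -> in_nbr D x = ~: B :\ x.
  move=> xB; apply/eqP; rewrite eqEcard sub_in //.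
  by have := ind x; have := cCB x xB; rewrite /indeg eCB; lia.
exists (~: B), B; split.
- by split; [rewrite setUC setUCr | rewrite disjoint_sym -subsets_disjoint].
- apply: complete_diso => // x y xB yB.
  have := inCB y; rewrite -in_setC yB => /(_ isT)/setP/(_ x).
  by rewrite !inE in xB yB *; rewrite xB andbT.
- apply: complete_diso => // x y xB yB.
  by have /setP/(_ y) := outB x xB; rewrite !inE yB andbT eq_sym.
- exact: noB.
split=> [x xB|y yB].
  have xB' : x \notin B by rewrite -in_setC.
  have := deg x; rewrite /degree /indeg inCB //.
  have -> : #|~: B :\ x| = n - 1 by have := cCB x xB'; lia.
  move=> out_ge; have : ~~ (out_nbr D x \subset ~: B :\ x).
    apply/negP => /subset_leq_card; have := cCB x xB'.
    by rewrite /outdeg in out_ge; lia.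
  case/subsetPn => y; rewrite !inE => xy; rewrite negb_and negbK => yP.
  exists y => //; apply: contraLR yP => yB; rewrite negb_or yB andbT.
  by apply: contraTneq xy => ->; rewrite irr.
have := deg y; rewrite /degree /outdeg outB //.
have -> : #|B :\ y| = n - 1 by have := cB y yB; lia.
move=> in_ge; have : ~~ (in_nbr D y \subset B :\ y).
  apply/negP => /subset_leq_card; have := cB y yB.
  by rewrite /indeg in in_ge; lia.
case/subsetPn => x; rewrite !inE => xy; rewrite negb_and negbK => xP.
exists x => //; rewrite inE; apply: contraL xP => xB; rewrite negb_or xB andbT.
by apply: contraTneq xy => ->; rewrite irr.
Qed.

End Closed.

(** * Bypasses of a cycle *)

Section Detours.

Variables (V : finType) (D : rel V) (C : {pred V}).

(** All vertices of the walk after its start avoid [C]; for [to_outside], all those before its end.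
    As instances of [connect] the relations compose without regard to repeated vertices. *)
Definition from_outside := connect (fun a b => D a b && (b \notin C)).
Definition to_outside := connect (fun a b => D a b && (a \notin C)).

Lemma from_outsideP c w : c \in C -> w \notin C -> from_outside c w ->
  exists u, [/\ path D c (rcons u w), all (fun a => a \notin C) (rcons u w)
              & uniq (rcons u w)].
Proof.
move=> cC wC /connectP[p pp ew].
case: (shortenP pp) ew => p' pp' up' _ ew.
case: p' pp' up' ew => [|a p'] pp' up' ew.
  by move: wC; rewrite ew /= cC.
exists (belast a p'); rewrite [w]ew /= -lastI.
split; last by case/andP: up'.
  by apply: sub_path pp' => ? ? /andP[].
apply/allP => b bp; have := pp'; case/splitPr: bp => p1 p2.
by rewrite cat_path /= => /and3P[_ /andP[]].
Qed.

Lemma to_outsideP c w : c \in C -> w \notin C -> to_outside w c ->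
  exists u, [/\ path D w (rcons u c), all (fun a => a \notin C) (w :: u)
              & uniq (w :: u)].
Proof.
move=> cC wC /connectP[p pp ec].
case: (shortenP pp) ec => p' pp' up' _ ec.
case/lastP: p' pp' up' ec => [|p' z] pp' up' ec.
  by move: wC; rewrite -[w]ec cC.
rewrite last_rcons in ec; rewrite -ec in pp' up' *.
exists p'; split.
- by apply: sub_path pp' => ? ? /andP[].
- elim: p' {1 2}w pp' {up' pp ec} => [|a p' IH] b /=; first by case/andP=> /andP[_ ->].
  by case/andP=> /andP[_ ->] /IH.
by move: up'; rewrite -rcons_cons rcons_uniq => /andP[].
Qed.

Lemma detour c c' w : c \in C -> c' \in C -> w \notin C ->
  from_outside c w -> to_outside w c' ->
  exists u, [/\ u != [::], path D c (rcons u c'), all (fun a => a \notin C) u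
              & uniq u].
Proof.
move=> cC c'C wC /(from_outsideP cC wC)[u1 [p1 a1 _]].
move=> /(to_outsideP c'C wC)[u2 [p2 a2 _]].
have : path D c (u1 ++ w :: rcons u2 c').
  by rewrite -cat_rcons cat_path p1 last_rcons.
have : all (fun a => a \notin C) (u1 ++ w :: u2).
  by rewrite -cat_rcons all_cat a1; case/andP: a2.
have -> : u1 ++ w :: rcons u2 c' = rcons (u1 ++ w :: u2) c' by rewrite rcons_cat.
have : u1 ++ w :: u2 != [::] by case: u1 {p1 a1}.
(* Only the part from the first outside vertex [a] on is shortened, so an inner vertex survives and
   [c = c'] does no harm. *)
case: (u1 ++ w :: u2) => // a p _ /= /andP[aC pC] /andP[ca].
rewrite rcons_path => /andP[pp lc'].
case: (shortenP pp) lc' => p' pp' up' sub lc'.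
exists (a :: p'); split=> //=; last rewrite aC /=.
  by rewrite ca rcons_path pp'.
by apply/allP => b bp'; apply: (allP pC); apply: sub.
Qed.

End Detours.

(** Strong connectivity in cut form: its failure is exactly the closed set used in the case of a
    digraph that is not strong. *)
Definition strong (V : finType) (D : rel V) :=
  forall A : {set V}, A != set0 -> A != setT ->
  exists u v, [/\ u \in A, v \notin A & D u v].

Section Bypass.

Variables (n : nat) (V : finType) (D : rel V).
Hypothesis irr : irreflexive D.
Hypothesis cardV : #|V| = 2 * n.
Hypothesis deg : forall x, 2 * n - 1 <= degree D x.
Hypothesis n_gt0 : 0 < n.
Hypothesis strongD : strong D.

Lemma strong_from (C : {pred V}) c w : c \in C ->
  exists2 c', c' \in C & from_outside D C c' w.
Proof.
move=> cC; pose A := [set w | [exists c', (c' \in C) && from_outside D C c' w]].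
have CA c' : c' \in C -> c' \in A.
  by move=> c'C; rewrite inE; apply/existsP; exists c'; rewrite c'C; apply: connect0.
have [AT|AT] := eqVneq A setT.
  have : w \in A by rewrite AT inE.
  by rewrite inE => /existsP[c' /andP[? ?]]; exists c'.
have A0 : A != set0 by apply/set0Pn; exists c; apply: CA.
have [u [v [uA vA uv]]] := strongD A0 AT; case/negP: (vA).
have vC : v \notin C by apply: contra vA; apply: CA.
move: uA; rewrite !inE => /existsP[c' /andP[c'C c'u]].
apply/existsP; exists c'; rewrite c'C; apply: connect_trans c'u _.
by apply: connect1; rewrite uv vC.
Qed.

Lemma strong_to (C : {pred V}) c w : c \in C ->
  exists2 c', c' \in C & to_outside D C w c'.
Proof.
move=> cC; pose A := [set w | ~~ [exists c', (c' \in C) && to_outside D C w c']].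
have CA c' : c' \in C -> c' \notin A.
  move=> c'C; rewrite inE negbK; apply/existsP; exists c'.
  by rewrite c'C; apply: connect0.
have [A0|A0] := eqVneq A set0.
  have : w \notin A by rewrite A0 inE.
  by rewrite inE negbK => /existsP[c' /andP[? ?]]; exists c'.
have AT : A != setT by apply: contraNneq (CA c cC) => ->; rewrite inE.
have [u [v [uA vA uv]]] := strongD A0 AT.
have uC : u \notin C by apply: contraL uA; apply: CA.
move: vA; rewrite inE negbK => /existsP[c' /andP[c'C vc']].
move: uA; rewrite inE => /negP; case; apply/existsP; exists c'; rewrite c'C.
by apply: connect_trans vc'; apply: connect1; rewrite uv uC.
Qed.

(* If all bypasses from [c] return to [c], then [c] separates the set [W] of the
   vertices on them from the rest, and the two sides are too small for the
   degree condition. *)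
Lemma bypass_exists (C : {pred V}) c1 c2 w :
  c1 \in C -> c2 \in C -> c1 != c2 -> w \notin C ->
  exists c c' u, [/\ c \in C, c' \in C, c != c' & u != [::]] /\
    [/\ path D c (rcons u c'), all (fun a => a \notin C) u & uniq u].
Proof.
move=> c1C c2C c12 wC.
pose bypass c c' x := [&& c \in C, c' \in C, c != c', x \notin C,
  from_outside D C c x & to_outside D C x c'].
have [|none] := boolP [exists c, [exists c', [exists x, bypass c c' x]]].
  case/existsP=> c /existsP[c' /existsP[x /and5P[cC c'C cc' xC /andP[cx xc']]]].
  have [u [u0 pu au uu]] := detour cC c'C xC cx xc'.
  by exists c, c', u.
exfalso.
have same c c' x : c \in C -> c' \in C -> x \notin C ->
    from_outside D C c x -> to_outside D C x c' -> c = c'.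
  move=> cC c'C xC cx xc'; apply: contraNeq none => cc'.
  apply/existsP; exists c; apply/existsP; exists c'; apply/existsP; exists x.
  by rewrite /bypass cC c'C cc' xC cx.
have [c cC cw] := strong_from w c1C.
pose W := [set x | (x \notin C) && from_outside D C c x].
have wW : w \in W by rewrite inE wC.
have to_c x : x \in W -> to_outside D C x c.
  rewrite inE => /andP[xC cx]; have [c' c'C xc'] := strong_to x c1C.
  by rewrite (same c c' x).
have outW x y : x \in W -> D x y -> y \in W \/ y = c.
  move=> xW xy; move: (xW); rewrite inE => /andP[xC cx].
  have [yC|yC] := boolP (y \in C).
    right; symmetry; apply: (same c y x) => //.
    by apply: connect1; rewrite xy xC.
  left; rewrite inE yC; apply: connect_trans cx _.
  by apply: connect1; rewrite xy yC.
have inW x y : x \in W -> D y x -> y \in W \/ y = c.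
  move=> xW yx; move: (xW); rewrite inE => /andP[xC cx].
  have [yC|yC] := boolP (y \in C).
    right; apply: (same y c x) => //; last exact: to_c.
    by apply: connect1; rewrite yx xC.
  have yc : to_outside D C y c.
    by apply: connect_trans (to_c x xW); apply: connect1; rewrite yx yC.
  have [c' c'C c'y] := strong_from y c1C.
  by left; rewrite inE yC -(same c' c y).
have cW : c \notin W by rewrite inE cC.
have [v vC vc] : exists2 v, v \in C & v != c.
  by have [e|e] := eqVneq c1 c; [exists c2; rewrite // eq_sym -e | exists c1].
have vW : v \notin W by rewrite inE vC.
have degw : degree D w <= 2 * #|W|.
  have eW : #|c |: W :\ w| = #|W|.
    by rewrite cardsU1 in_setD1 (negPf cW) andbF (cardsD1 w W) wW.
  rewrite mul2n -addnn /degree leq_add // -eW; apply: subset_leq_card;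
    apply/subsetP => y; rewrite inE in_setU1 in_setD1 => wy.
    have yw : y != w by apply: contraTneq wy => ->; rewrite irr.
    by case: (outW w y wW wy) => [->|->]; rewrite ?eqxx // yw orbT.
  have yw : y != w by apply: contraTneq wy => ->; rewrite irr.
  by case: (inW w y wW wy) => [->|->]; rewrite ?eqxx // yw orbT.
have degv : degree D v <= 2 * (#|V| - #|W| - 1).
  have eW : #|~: (v |: W)| = #|V| - #|W| - 1.
    by have := cardsC (v |: W); rewrite cardsU1 vW; lia.
  have out_v y : D v y -> y \in ~: (v |: W).
    move=> vy; rewrite in_setC in_setU1 negb_or; apply/andP; split.
      by apply: contraTneq vy => ->; rewrite irr.
    apply/negP => yW; case: (inW y v yW vy) => [|e]; first exact/negP.
    by rewrite e eqxx in vc.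
  have in_v y : D y v -> y \in ~: (v |: W).
    move=> yv; rewrite in_setC in_setU1 negb_or; apply/andP; split.
      by apply: contraTneq yv => ->; rewrite irr.
    apply/negP => yW; case: (outW y v yW yv) => [|e]; first exact/negP.
    by rewrite e eqxx in vc.
  rewrite -eW mul2n -addnn /degree leq_add //; apply: subset_leq_card;
    by apply/subsetP => y; rewrite inE => vy; auto.
have leW : #|W| <= #|V| by rewrite -cardsT; apply/subset_leq_card/subsetT.
(* The bound for [w] gives [#|W| >= n], the one for [v] gives [#|W| <= n - 1]. *)
have := deg w; have := deg v.
by move: leW degv; rewrite cardV; lia.
Qed.

End Bypass.

Section Configurations.

Variables (V : finType) (D : rel V).

(* Two disjoint detours [g] and [u] close the same path [x :: q] to a cycle. *)
Definition theta (x : V) (q g u : seq V) :=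
  [/\ uniq (x :: q ++ g ++ u), path D x q, path D (last x q) (rcons g x),
      path D (last x q) (rcons u x) & (q != [::]) && (u != [::])].

Definition shortcut_free (x : V) (q g : seq V) :=
  forall w v, w \notin x :: q ++ g -> v \in g ->
  (from_outside D (mem (x :: q ++ g)) (last x q) w -> ~~ D w v) /\
  (to_outside D (mem (x :: q ++ g)) w x -> ~~ D v w).

(** The cycle is kept but read from [v]: the common path is now [v, g2, x, q], the bypassed segment
    is [g1], and the bypass is the walk to [w], which returns by [w -> v]. *)
Lemma shortcut_from x q g1 v g2 u w :
  theta x q (g1 ++ v :: g2) u -> w \notin x :: q ++ g1 ++ v :: g2 ->
  from_outside D (mem (x :: q ++ g1 ++ v :: g2)) (last x q) w -> D w v ->
  exists u', theta v (g2 ++ x :: q) g1 u'.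
Proof.
set C := mem _ => -[uq pq pg pu /andP[q0 _]] wC rw wv.
have lC : last x q \in x :: q ++ g1 ++ v :: g2.
  by rewrite -cat_cons mem_cat mem_last.
have [u' [pu' au' uu']] := from_outsideP lC wC rw.
exists (rcons u' w); move: pg; rewrite -cats1 -catA cat_path /= => /and3P[pg1 lv pg2].
have last_new : last v (g2 ++ x :: q) = last x q by rewrite last_cat.
split.
- have -> : uniq (v :: (g2 ++ x :: q) ++ g1 ++ rcons u' w) =
      uniq ((x :: q ++ g1 ++ v :: g2) ++ rcons u' w).
    apply/perm_uniq/permP => a.
    rewrite -(cats1 u' w) /= !count_cat /= ?count_cat /=.
    by clear; lia.
  rewrite cat_uniq uu' andbT; apply/andP; split.
    by move: uq; rewrite -!cat_cons !catA cat_uniq => /andP[].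
  by apply/hasPn => z /(allP au').
- by rewrite cat_path; move: pg2; rewrite cat_path /= andbT => /andP[-> ->].
- by rewrite last_new rcons_path pg1 lv.
- by rewrite last_new rcons_path pu' last_rcons.
by case: (g2) => [|? ?]; case: (u').
Qed.

(** Dually, the common path grows by [g1] and [v], and only [g2] is still bypassed. *)
Lemma shortcut_to x q g1 v g2 u w :
  theta x q (g1 ++ v :: g2) u -> w \notin x :: q ++ g1 ++ v :: g2 ->
  to_outside D (mem (x :: q ++ g1 ++ v :: g2)) w x -> D v w ->
  exists u', theta x (q ++ rcons g1 v) g2 u'.
Proof.
set C := mem _ => -[uq pq pg pu /andP[q0 _]] wC rw vw.
have xC : x \in x :: q ++ g1 ++ v :: g2 by rewrite mem_head.
have [u' [pu' au' uu']] := to_outsideP xC wC rw.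
exists (w :: u'); move: pg; rewrite -cats1 -catA cat_path /= => /and3P[pg1 lv pg2].
have last_new : last x (q ++ rcons g1 v) = v by rewrite last_cat last_rcons.
split.
- have -> : uniq (x :: (q ++ rcons g1 v) ++ g2 ++ w :: u') =
      uniq ((x :: q ++ g1 ++ v :: g2) ++ w :: u').
    apply/perm_uniq/permP => a.
    rewrite -(cats1 g1 v) /= !count_cat /= ?count_cat /=.
    by clear; lia.
  rewrite cat_uniq uu' andbT; apply/andP; split.
    by move: uq; rewrite -!cat_cons !catA cat_uniq => /andP[].
  by apply/hasPn => z /(allP au').
- by rewrite cat_path pq rcons_path pg1.
- by rewrite last_new -cats1.
- by rewrite last_new rcons_cons /= vw.
by case: (q) q0.
Qed.

(* A shortcut yields a configuration with a shorter [g] on a cycle of the same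
   length. *)
Lemma theta_shortcut_free x q g u :
  theta x q g u ->
  exists x' q' g' u', [/\ theta x' q' g' u', shortcut_free x' q' g' &
                          size (x' :: q' ++ g') = size (x :: q ++ g)].
Proof.
move: {2}(size g) (leqnn (size g)) => s.
elim: s x q g u => [|s IH] x q g u gs th.
  by exists x, q, g, u; split=> // w v _; case: g gs th.
set C := mem (x :: q ++ g).
pose bad w v := [&& w \notin C, v \in g &
  (from_outside D C (last x q) w && D w v) || (to_outside D C w x && D v w)].
have [|ok] := boolP [exists w, [exists v, bad w v]]; last first.
  exists x, q, g, u; split=> // w v wC vg.
  have : ~~ bad w v.
    by apply: contra ok => b; apply/existsP; exists w; apply/existsP; exists v.
  rewrite /bad wC vg /= negb_or !negb_and => /andP[b1 b2].
  by split=> r; [move: b1 | move: b2]; rewrite r.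
case/existsP=> w /existsP[v /and3P[wC vg]].
have [g1 [g2 eg]] : exists g1 g2, g = g1 ++ v :: g2.
  by case/splitPr: vg => g1 g2; exists g1, g2.
rewrite /C eg in gs th wC *; rewrite size_cat /= in gs.
case/orP=> /andP[rw wv].
  have [u' th'] := shortcut_from th wC rw wv.
  have [|x' [q' [g' [u'' [t f e]]]]] := IH _ _ _ _ _ th'; first by lia.
  by exists x', q', g', u''; split=> //; rewrite e /= !size_cat /= ?size_cat /=; lia.
have [u' th'] := shortcut_to th wC rw wv.
have [|x' [q' [g' [u'' [t f e]]]]] := IH _ _ _ _ _ th'; first by lia.
by exists x', q', g', u''; split=> //; rewrite e /= !size_cat /= size_rcons; lia.
Qed.

End Configurations.

(** * Meyniel's degree count *)

Lemma sum_seq_eq_termwise (T : eqType) (s : seq T) (F G : T -> nat) :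
  {in s, forall w, F w <= G w} ->
  \sum_(w <- s) G w <= \sum_(w <- s) F w -> {in s, forall w, F w = G w}.
Proof.
elim: s => [|a s IH] leFG; first by [].
have leS : \sum_(w <- s) F w <= \sum_(w <- s) G w.
  by rewrite !big_seq; apply: leq_sum => w ws; apply: leFG; rewrite inE ws orbT.
have lea := leFG a (mem_head a s).
rewrite !big_cons => leGF w; rewrite inE => /orP[/eqP ->|]; first by lia.
apply: IH; last by lia.
by move=> z zs; apply: leFG; rewrite inE zs orbT.
Qed.

Lemma sum_seq_neq (T : eqType) (s : seq T) (v : T) : uniq s -> v \in s ->
  \sum_(w <- s) 2 * (w != v) = 2 * (size s).-1.
Proof.
move=> us vs; rewrite -big_distrr /= (perm_big _ (perm_to_rem vs)) /=.
rewrite big_cons eqxx add0n -(size_rem vs) -sum1_size; congr (_ * _).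
rewrite !big_seq; apply: eq_bigr => w; rewrite mem_rem_uniq // inE => /andP[-> _].
by [].
Qed.

Section Adjacency.

Variables (V : finType) (D : rel V).

Definition arcs (z w : V) : nat := D z w + D w z.

Definition adj (z : V) (s : seq V) : nat := \sum_(w <- s) arcs z w.

Lemma arcs_le2 z w : arcs z w <= 2.
Proof. by rewrite /arcs; case: (D z w); case: (D w z). Qed.

Lemma adj_cat z s1 s2 : adj z (s1 ++ s2) = adj z s1 + adj z s2.
Proof. exact: big_cat. Qed.

Lemma adj_perm z s1 s2 : perm_eq s1 s2 -> adj z s1 = adj z s2.
Proof. exact: perm_big. Qed.

Lemma degree_adj z s : uniq s -> (forall x, x \in s) -> degree D z = adj z s.
Proof.
move=> us sT; rewrite /adj /arcs big_split /= /degree /outdeg /indeg.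
have card_sum (P : pred V) : #|[set x | P x]| = \sum_(w <- s) P w.
  rewrite -sum1dep_card big_mkcond /= [RHS](perm_big (enum V)); last first.
    by apply: uniq_perm; rewrite ?enum_uniq // => x; rewrite sT mem_enum.
  by rewrite big_enum; apply: eq_bigr => w _; case: (P w).
by rewrite !card_sum.
Qed.

(** [v] fits into no step of the path [x :: p]. In the extremal case [tight] each step carries
    exactly one of the two arcs that an insertion needs. *)
Definition rigid (v : V) (x : V) (p : seq V) :=
  path (fun a b => ~~ (D a v && D v b)) x p.

Definition tight (v : V) (x : V) (p : seq V) :=
  path (fun a b => D v b == ~~ D a v) x p.

Lemma not_rigid v x p : ~~ rigid v x p ->
  exists p1 b p2, [/\ p = p1 ++ b :: p2, D (last x p1) v & D v b].
Proof.
elim: p x => [|b p IH] x //=; rewrite negb_and negbK.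
case/orP=> [/andP[xv vb]|/IH[p1 [c [p2 [-> lv vc]]]]].
  by exists [::], b, p.
by exists (b :: p1), c, p2.
Qed.

(** Pairing [a -> v] with [v -> b] for each step [a -> b] leaves unpaired only [v -> x] and the arc
    from the last vertex to [v]. *)
Lemma adj_rigid v x p : rigid v x p ->
  adj v (x :: p) <= size p + D v x + D (last x p) v.
Proof.
rewrite /adj; elim: p x => [|b p IH] x /=; first by rewrite big_seq1 /arcs; lia.
rewrite big_cons => /andP[xb /IH]; rewrite /arcs.
by case: (D x v) xb; case: (D v b) => //= _; case: (D v x); lia.
Qed.

Lemma adj_tight v x p : rigid v x p -> size p + 2 <= adj v (x :: p) ->
  [/\ D v x, D (last x p) v & tight v x p].
Proof.
move=> rv le.
have [vx lv] : D v x /\ D (last x p) v.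
  by have := adj_rigid rv; case: (D v x); case: (D _ v) => //; lia.
split=> //; have {le} : size p + D v x + D (last x p) v <= adj v (x :: p).
  by rewrite vx lv; lia.
elim: p x rv {vx lv} => //= b p IH x /andP[xb rv].
have := adj_rigid rv; rewrite {2}/adj big_cons -/(adj v (b :: p)) {1}/arcs => le1 le2.
have lep : size p + D v b + D (last b p) v <= adj v (b :: p).
  by move: xb le1 le2; case: (D x v); case: (D v b); case: (D v x) => //=; lia.
rewrite IH // andbT; move: xb le1 le2.
by case: (D x v); case: (D v b); case: (D v x) => //=; lia.
Qed.

Lemma complete_path (s : seq V) x : {in x :: s &, forall a b, a != b -> D a b} ->
  uniq (x :: s) -> path D x s.
Proof.
elim: s x => //= b s IH x compl /and3P[xs bs us]; rewrite compl ?inE ?eqxx ?orbT //.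
  apply: IH; last by rewrite /= bs.
  by move=> a c ab cb; apply: compl; rewrite inE ?ab ?cb orbT.
by apply: contraNneq xs => ->; rewrite mem_head.
Qed.

Lemma cycle_replace s1 a t t' c s2 :
  cycle D (s1 ++ a :: t ++ c :: s2) -> path D a (rcons t' c) ->
  cycle D (s1 ++ a :: t' ++ c :: s2).
Proof.
have rotE r : cycle D (s1 ++ a :: r ++ c :: s2) =
    path D a (rcons r c) && path D c (rcons (s2 ++ s1) a).
  rewrite -(rot_cycle (size s1)) rot_size_cat /= -catA /= rcons_cat /=.
  by rewrite cat_path /= [path D a (rcons r c)]rcons_path -andbA.
by rewrite !rotE => /andP[_ ->] ->.
Qed.

End Adjacency.

Lemma mem_cat_split (T : eqType) (z : T) s :
  z \in s -> exists s1 s2, s = s1 ++ z :: s2.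
Proof. by case/splitPr=> s1 s2; exists s1, s2. Qed.

(** Equal sizes of [G] and [Y] make the record symmetric in the two blobs, including the clause on
    longest cycles. *)
Record two_blobs n (V : finType) (D : rel V) (x : V) (q G Y : seq V) : Prop :=
  TwoBlobs {
  blobs_uniq : uniq (x :: q ++ G ++ Y);
  blobs_cover : forall z, z \in x :: q ++ G ++ Y;
  blobs_path : path D x q;
  blobs_q : q != [::];
  blobs_G : 0 < size G;
  blobs_size : size Y = size G;
  blobs_complG : {in G &, forall a b, a != b -> D a b};
  blobs_complY : {in Y &, forall a b, a != b -> D a b};
  blobs_nonadj : forall a b, a \in G -> b \in Y -> (D a b = false) * (D b a = false);
  blobs_head : forall z, z \in G ++ Y -> D z x;
  blobs_last : forall z, z \in G ++ Y -> D (last x q) z;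
  blobs_tight : forall z, z \in G ++ Y -> tight D z x q;
  blobs_degree : forall z, z \in G ++ Y -> degree D z = 2 * n - 1;
  blobs_longest : forall c, cycle D c -> uniq c -> size c <= size (x :: q ++ G)
}.

(** * Equality in the degree count for a longest cycle with a shortest bypassed segment *)

Section Meyniel.

Variables (n : nat) (V : finType) (D : rel V) (m : nat).
Hypothesis irr : irreflexive D.
Hypothesis cardV : #|V| = 2 * n.
Hypothesis n_ge3 : 3 <= n.
Hypothesis deg : forall x, 2 * n - 1 <= degree D x.
Hypothesis out : forall x, n - 1 <= outdeg D x.
Hypothesis ind : forall x, n - 1 <= indeg D x.
Hypothesis longest : forall c, cycle D c -> uniq c -> size c <= m.

Variables (x : V) (q g u : seq V).
Hypothesis th : theta D x q g u.
Hypothesis free : shortcut_free D x q g.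
Hypothesis size_m : size (x :: q ++ g) = m.

Local Notation C := (x :: q ++ g).
Local Notation arcs := (arcs D).
Local Notation adj := (adj D).
Let r := [seq w <- enum V | w \notin C].
Let P w := from_outside D (mem C) (last x q) w.
Let S w := to_outside D (mem C) w x.

Lemma theta_uniqC : uniq C.
Proof. by case: th => + _ _ _ _; rewrite catA -cat_cons cat_uniq => /andP[]. Qed.

Lemma theta_path : path D x q. Proof. by case: th. Qed.

Lemma theta_close : path D (last x q) (rcons g x). Proof. by case: th. Qed.

Lemma theta_cycle : cycle D C.
Proof. by rewrite /= rcons_cat cat_path theta_path theta_close. Qed.

Lemma mem_r w : (w \in r) = (w \notin C).
Proof. by rewrite mem_filter mem_enum inE andbT. Qed.

Lemma uniq_r : uniq r. Proof. by rewrite filter_uniq ?enum_uniq. Qed.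

Lemma perm_C_r : perm_eq (C ++ r) (enum V).
Proof.
apply: uniq_perm; rewrite ?enum_uniq //; last first.
  by move=> w; rewrite mem_cat mem_r mem_enum inE orbN.
rewrite cat_uniq theta_uniqC uniq_r andbT /=.
by apply/hasPn => w; rewrite mem_r.
Qed.

Lemma size_r : m + size r = 2 * n.
Proof. by rewrite -cardV cardE -(perm_size perm_C_r) size_cat size_m. Qed.

Lemma degree_split z : degree D z = adj z (x :: q) + adj z g + adj z r.
Proof.
rewrite (degree_adj D z (s := C ++ r)); last 2 first.
- by rewrite (perm_uniq perm_C_r) enum_uniq.
- by move=> w; rewrite (perm_mem perm_C_r) mem_enum.
by rewrite -cat_cons !adj_cat.
Qed.

(** Replacing the step into [b] by the given path would lengthen a longest cycle. *)
Lemma insert_outside p1 b p2 t w :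
  q = p1 ++ b :: p2 -> path D (last x p1) (rcons (w :: t) b) ->
  uniq (w :: t) -> {in w :: t, forall z, z \notin C} -> False.
Proof.
move=> eq pt ut tC.
have eC : C = belast x p1 ++ last x p1 :: [::] ++ b :: p2 ++ g.
  by rewrite eq -catA cat_cons -cat_cons (lastI x p1) cat_rcons.
have cC : cycle D (belast x p1 ++ last x p1 :: [::] ++ b :: p2 ++ g).
  by rewrite -eC theta_cycle.
have cC' := cycle_replace cC pt.
have pC : perm_eq (belast x p1 ++ last x p1 :: (w :: t) ++ b :: p2 ++ g)
                  (C ++ w :: t).
  by apply/permP => a; rewrite eC !count_cat /= !count_cat /= ?count_cat; clear; lia.
have := longest cC'; rewrite (perm_uniq pC) (perm_size pC) size_cat size_m.
rewrite cat_uniq theta_uniqC ut andbT => le; suff: m + size (w :: t) <= m by rewrite /=; lia.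
by apply: le; apply/hasPn => z /tC.
Qed.

Lemma shortcut_P w v : w \in r -> v \in g -> P w -> D w v = false.
Proof. by rewrite mem_r => wC vg Pw; apply/negbTE; case: (free wC vg) => h _; apply: h. Qed.

Lemma shortcut_S w v : w \in r -> v \in g -> S w -> D v w = false.
Proof. by rewrite mem_r => wC vg Sw; apply/negbTE; case: (free wC vg) => _ h; apply: h. Qed.

Lemma P_arc a b : P a -> D a b -> b \in r -> P b.
Proof.
move=> Pa ab; rewrite mem_r => bC; apply: connect_trans Pa _.
by apply: connect1; rewrite ab bC.
Qed.

Lemma S_arc a b : S b -> D a b -> a \in r -> S a.
Proof.
move=> Sb ab; rewrite mem_r => aC; apply: connect_trans Sb.
by apply: connect1; rewrite ab aC.
Qed.

Lemma P_last w : D (last x q) w -> w \in r -> P w.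
Proof. by rewrite mem_r => lw wC; apply: connect1; rewrite lw wC. Qed.

Lemma S_head w : D w x -> w \in r -> S w.
Proof. by rewrite mem_r => wx wC; apply: connect1; rewrite wx wC. Qed.

(** The vertices on walks off the cycle from the end of [q] to its start: the candidates for the
    second blob, which turn out to be all of [r]. *)
Let Y := [seq w <- r | P w && S w].

Lemma mem_Y w : (w \in Y) = [&& P w, S w & w \in r].
Proof. by rewrite mem_filter -andbA. Qed.

Lemma rigid_outside y : y \in r -> rigid D y x q.
Proof.
rewrite mem_r => yC; apply: contraT => /not_rigid[p1 [b [p2 [eq ay yb]]]]; exfalso.
apply: (insert_outside (w := y) (t := [::]) eq) => //=; first by rewrite ay yb.
by move=> z; rewrite inE => /eqP ->.
Qed.

(* A path [v -> w -> y] or [y -> w -> v] would be a shortcut. *)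
Lemma detours_disjoint v y w : v \in g -> y \in Y -> w \in r ->
  arcs v w + arcs y w <= 2 * (w != y).
Proof.
move=> vg; rewrite mem_Y => /and3P[Py Sy yr] wr; rewrite /arcs.
have [->|wy] := eqVneq w y.
  by rewrite irr (shortcut_P yr vg Py) (shortcut_S yr vg Sy).
have : ~~ (D v w && D w y).
  by apply/negP => /andP[vw wy']; rewrite (shortcut_S wr vg (S_arc Sy wy' wr)) in vw.
have : ~~ (D y w && D w v).
  by apply/negP => /andP[yw wv]; rewrite (shortcut_P wr vg (P_arc Py yw wr)) in wv.
by case: (D v w); case: (D w v); case: (D y w); case: (D w y).
Qed.

Lemma Y_nonadj v y : v \in g -> y \in Y -> (D v y = false) * (D y v = false).
Proof.
move=> vg; rewrite mem_Y => /and3P[Py Sy yr].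
by rewrite (shortcut_S yr vg Sy) (shortcut_P yr vg Py).
Qed.

Lemma adj_Y_g y : y \in Y -> adj y g = 0.
Proof.
move=> yY; rewrite /adj big_seq big1 // => v vg.
by rewrite /arcs !(Y_nonadj vg yY).
Qed.

Lemma path_to_outside (A : {pred V}) c w t :
  path D w (rcons t c) -> all (fun a => a \notin A) (w :: t) -> to_outside D A w c.
Proof.
elim: t w => [|a t IH] w /=.
  by rewrite !andbT => wc wA; apply: connect1; rewrite wc wA.
move=> /andP[wa pt] /andP[wA tA]; apply: connect_trans (IH a pt tA).
by apply: connect1; rewrite wa wA.
Qed.

Lemma exists_Y : exists y, y \in Y.
Proof.
case: (th) => uq _ _ pu /andP[_]; case: u uq pu => // y t uq pu _.
have tC : all (fun a => a \notin C) (y :: t).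
  move: uq; rewrite catA -cat_cons cat_uniq => /and3P[_ /hasPn h _].
  by apply/allP => a /h.
exists y; have yr : y \in r by rewrite mem_r; case/andP: tC.
move: pu => /= /andP[ly py]; rewrite mem_Y yr P_last // /S.
by rewrite (path_to_outside py).
Qed.

(** The vertices of [g] left out by [p] need not form a path. Only the ends of [p] matter, since the
    bypass [u] joins them. *)
Definition extension p := [/\ path D x p, last x p = last x q, uniq (x :: p),
  {subset q <= p} & {subset p <= q ++ g}].

Lemma extension_insert p v : extension p -> v \in g -> v \notin p ->
  ~~ rigid D v x p -> exists2 p', extension p' & size p' = (size p).+1.
Proof.
move=> [pp lp up qp pg] vg vp /not_rigid[p1 [b [p2 [ep av vb]]]].
have xv : x != v.
  apply: contraTneq vg => <-; have := theta_uniqC.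
  by rewrite /= mem_cat negb_or => /andP[/andP[]].
exists (p1 ++ v :: b :: p2); last by rewrite ep !size_cat /= addnS.
rewrite ep in pp lp up qp pg vp; split.
- by move: pp; rewrite !cat_path /= => /and3P[-> _ ->]; rewrite av vb.
- by rewrite -lp !last_cat.
- have -> : uniq (x :: p1 ++ v :: b :: p2) = uniq (v :: x :: p1 ++ b :: p2).
    by apply/perm_uniq/permP => a; rewrite /= !count_cat /=; clear; lia.
  by rewrite cons_uniq up andbT inE negb_or eq_sym xv.
- by move=> z /qp; rewrite !mem_cat !inE => /orP[->//|->]; rewrite !orbT.
move=> z; rewrite mem_cat inE => /or3P[zp|/eqP ->|zp].
- by apply: pg; rewrite mem_cat zp.
- by rewrite mem_cat vg orbT.
by apply: pg; rewrite mem_cat zp orbT.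
Qed.

Lemma extension_stuck p0 : extension p0 ->
  exists p, [/\ extension p, size p0 <= size p &
    {in g, forall v, v \notin p -> rigid D v x p}].
Proof.
move: {2}(size (q ++ g) - size p0) (leqnn (size (q ++ g) - size p0)) => d.
elim: d p0 => [|d IH] p0 le_d ext.
  exists p0; split=> // v vg vp; apply: contraT => nr.
  have [p [_ _ /andP[_ up] _ pg] sp] := extension_insert ext vg vp nr.
  have := uniq_leq_size up pg; rewrite sp => lt.
  by move: le_d; rewrite leqn0 subn_eq0 leqNgt lt.
have [|stuck] := boolP (has (fun v => (v \notin p0) && ~~ rigid D v x p0) g); last first.
  exists p0; split=> // v vg vp; apply: contraT => nr.
  by case/hasP: stuck; exists v; rewrite // vp.
case/hasP=> v vg /andP[vp nr].
have [p1 ext1 s1] := extension_insert ext vg vp nr.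
have [|p [extp le_p stuck]] := IH p1 _ ext1; first by rewrite s1; lia.
by exists p; split=> //; rewrite s1 in le_p; lia.
Qed.

Lemma adj_in v s : uniq s -> v \in s -> adj v s <= 2 * (size s).-1.
Proof.
move=> us vs; rewrite -(sum_seq_neq us vs) /adj !big_seq; apply: leq_sum => w ws.
by have [->|_] := eqVneq w v; rewrite ?arcs_le2 // /arcs irr.
Qed.

Lemma adj_rigid_le v p : rigid D v x p -> adj v (x :: p) <= size p + 2.
Proof. by move=> /adj_rigid; case: (D v x); case: (D _ v); lia. Qed.

Lemma adj_r_sum v y : v \in g -> y \in Y -> adj v r + adj y r <= 2 * (size r).-1.
Proof.
move=> vg yY; have yr : y \in r by move: yY; rewrite mem_Y => /and3P[].
rewrite -(sum_seq_neq uniq_r yr) /adj -big_split /= !big_seq; apply: leq_sum => w wr.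
exact: detours_disjoint.
Qed.

(* Meyniel's count: the degrees of [y] and of a vertex [v] of [g] missed by [p]
   add up to at most [4 * n - 2 + size q - size p]. *)
Lemma extension_short p : extension p ->
  {in g, forall v, v \notin p -> rigid D v x p} -> size p <= size q.
Proof.
move=> [pp lp up qp pg] stuck; have [y yY] := exists_Y.
have yr : y \in r by move: yY; rewrite mem_Y => /and3P[].
pose rest := [seq v <- g | v \notin p].
have xg v : v \in g -> v != x.
  by move=> vg; apply: contraTneq vg => ->; have := theta_uniqC;
     rewrite /= mem_cat negb_or => /andP[/andP[]].
have qg v : v \in g -> v \notin q.
  move=> vg; have := theta_uniqC; rewrite cons_uniq cat_uniq => /and4P[_ _ h _].
  by apply: contra h => vq; apply/hasP; exists v.
have ug : uniq g by have := theta_uniqC; rewrite -cat_cons cat_uniq => /and3P[].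
have perm_rest : perm_eq (p ++ rest) (q ++ g).
  apply: uniq_perm.
  - have up' : uniq p by move: up; rewrite cons_uniq => /andP[].
    rewrite cat_uniq up' filter_uniq // andbT.
    by apply/hasPn => v; rewrite mem_filter => /andP[].
  - by have := theta_uniqC => /andP[].
  move=> v; rewrite !mem_cat mem_filter; apply/orP/orP.
    by case=> [/pg|/andP[_ ->]]; [rewrite mem_cat => /orP | right].
  case=> [/qp ->|->]; first by left.
  by case: (v \in p); [left | right].
have size_rest : size p + size rest = size q + size g.
  by have := perm_size perm_rest; rewrite !size_cat.
(* If [p] absorbed all of [g], closing it through [u] would give a longer cycle. *)
have [e|rest0] := eqVneq (size rest) 0.
  exfalso; case: (th) => uq _ _ pu /andP[_ u0].
  have cyc : cycle D (x :: p ++ u) by rewrite /= rcons_cat cat_path pp lp pu.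
  have unq : uniq (x :: p ++ u).
    have /perm_uniq -> : perm_eq (x :: p ++ u) (x :: q ++ g ++ u).
      have -> : x :: p ++ u = x :: (p ++ rest) ++ u by rewrite (size0nil e) cats0.
      by rewrite (catA q) perm_cons perm_cat2r.
    by [].
  have := longest cyc unq; rewrite -size_m /= !size_cat.
  move: size_rest u0; rewrite e -size_eq0.
  by move: (size p) (size q) (size g) (size u); clear; lia.
have [v vrest] : exists v, v \in rest.
  by case: (rest) rest0 => // v s _; exists v; rewrite mem_head.
move: (vrest); rewrite mem_filter => /andP[vp vg].
have dv : degree D v = adj v (x :: p) + adj v rest + adj v r.
  rewrite degree_split -!adj_cat; apply: adj_perm; rewrite perm_cat2r.
  by rewrite !cat_cons perm_cons perm_sym.
have dy := degree_split y; rewrite adj_Y_g // addn0 in dy.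
have le1 := adj_rigid_le (stuck v vg vp).
have le2 := adj_rigid_le (rigid_outside yr).
have le3 : adj v rest <= 2 * (size rest).-1 := adj_in (filter_uniq _ ug) vrest.
have le4 : adj v r + adj y r <= 2 * (size r).-1 := adj_r_sum vg yY.
have := deg v; have := deg y; rewrite dv dy.
have r0 : 0 < size r by case: (r) yr.
have := size_r; move: size_m le1 le2 le3 le4 r0 rest0 size_rest; rewrite /= size_cat.
move: (size p) (size q) (size g) (size rest) (size r) (adj v (x :: p)).
move: (adj y (x :: q)) (adj v rest) (adj v r) (adj y r).
by clear; lia.
Qed.

(** A vertex of [g] that fits into [q] starts an extension longer than [q]; continued until nothing
    more fits, it contradicts the degree count. *)
Lemma rigid_g v : v \in g -> rigid D v x q.
Proof.
move=> vg; apply: contraT => nr.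
have ext : extension q.
  split=> //; [exact: theta_path | | by move=> z zq; rewrite mem_cat zq].
  by have := theta_uniqC; rewrite -cat_cons cat_uniq => /andP[].
have vq : v \notin q.
  have := theta_uniqC; rewrite cons_uniq cat_uniq => /and4P[_ _ h _].
  by apply: contra h => vq; apply/hasP; exists v.
have [p1 ext1 s1] := extension_insert ext vg vq nr.
have [p [extp le_p stuck]] := extension_stuck ext1.
by have := extension_short extp stuck; lia.
Qed.

Lemma uniq_g : uniq g.
Proof. by have := theta_uniqC; rewrite -cat_cons cat_uniq => /and3P[]. Qed.

Lemma g_neq0 : 0 < size g.
Proof.
rewrite lt0n; apply/negP => /eqP/size0nil g0.
case: (th) => uq pq _ pu /andP[_ u0].
have cyc : cycle D (x :: q ++ u) by rewrite /= rcons_cat cat_path pq pu.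
have unq : uniq (x :: q ++ u) by move: uq; rewrite g0.
have := longest cyc unq; rewrite -size_m g0 cats0 /= size_cat; move: u0.
by rewrite -size_eq0; move: (size q) (size u); clear; lia.
Qed.

Lemma arcs_in v w : arcs v w <= 2 * (w != v).
Proof. by have [->|_] := eqVneq w v; rewrite ?arcs_le2 // /arcs irr. Qed.

(** The bounds add up to [2 * (size q + 2) + 2 * (size g - 1) + 2 * (size r - 1) = 4 * n - 2], which
    is what the two degrees require, so each of them is attained. *)
Lemma meyniel_equality v y : v \in g -> y \in Y ->
  [/\ adj v (x :: q) = size q + 2, adj y (x :: q) = size q + 2,
      adj v g = 2 * (size g).-1, degree D v = 2 * n - 1 & degree D y = 2 * n - 1] /\
  adj v r + adj y r = 2 * (size r).-1.
Proof.
move=> vg yY; have yr : y \in r by move: yY; rewrite mem_Y => /and3P[].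
have dv := degree_split v; have dy := degree_split y.
rewrite adj_Y_g // addn0 in dy.
have le1 := adj_rigid_le (rigid_g vg).
have le2 := adj_rigid_le (rigid_outside yr).
have le3 := adj_in uniq_g vg.
have le4 := adj_r_sum vg yY.
have r0 : 0 < size r by case: (r) yr.
have g0 := g_neq0.
have := deg v; have := deg y; have := size_r; move: size_m.
move: le1 le2 le3 le4 r0 g0; rewrite dv dy /= size_cat.
move: (size q) (size g) (size r) (adj v (x :: q)).
move: (adj y (x :: q)) (adj v g) (adj v r) (adj y r).
by clear; split; [split|]; lia.
Qed.

Lemma g_tight v : v \in g -> [/\ D v x, D (last x q) v & tight D v x q].
Proof.
move=> vg; have [y yY] := exists_Y; have [[e _ _ _ _] _] := meyniel_equality vg yY.
by apply: (adj_tight (rigid_g vg)); rewrite [X in _ <= X]e.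
Qed.

Lemma exists_g : exists v, v \in g.
Proof. by case: (g) g_neq0 => // v s _; exists v; rewrite mem_head. Qed.

Lemma Y_tight y : y \in Y -> [/\ D y x, D (last x q) y & tight D y x q].
Proof.
move=> yY; have [v vg] := exists_g; have [[_ e _ _ _] _] := meyniel_equality vg yY.
have yr : y \in r by move: yY; rewrite mem_Y => /and3P[].
by apply: (adj_tight (rigid_outside yr)); rewrite e.
Qed.

Lemma g_complete : {in g &, forall v w, v != w -> D v w}.
Proof.
move=> v w vg wg vw; have [y yY] := exists_Y.
have [[_ _ e _ _] _] := meyniel_equality vg yY.
have := @sum_seq_eq_termwise _ g (arcs v) (fun w => 2 * (w != v)) _ _ w wg.
rewrite sum_seq_neq ?uniq_g // -/(adj v g) e eq_sym vw.
by rewrite /arcs => /(_ (fun w _ => arcs_in v w) (leqnn _)); case: (D v w); case: (D w v).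
Qed.

Lemma arcs_outside v y w : v \in g -> y \in Y -> w \in r ->
  arcs v w + arcs y w = 2 * (w != y).
Proof.
move=> vg yY wr; have [_ e] := meyniel_equality vg yY.
have yr : y \in r by move: yY; rewrite mem_Y => /and3P[].
apply: (@sum_seq_eq_termwise _ r (fun w => arcs v w + arcs y w)
  (fun w => 2 * (w != y)) _ _ w wr).
  by move=> z zr; apply: detours_disjoint.
by rewrite sum_seq_neq ?uniq_r // big_split /= -e.
Qed.

(** [w] has no arc with [v], so both arcs that equality grants to the pair [v], [y] at [w] belong to
    [y]. *)
Lemma Y_complete : {in Y &, forall y w, y != w -> D y w}.
Proof.
move=> y w yY wY yw; have [v vg] := exists_g.
have wr : w \in r by move: wY; rewrite mem_Y => /and3P[].
have := arcs_outside vg yY wr; rewrite /arcs !(Y_nonadj vg wY) eq_sym yw.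
by case: (D y w); case: (D w y).
Qed.

Lemma uniq_Y : uniq Y. Proof. by rewrite filter_uniq ?uniq_r. Qed.

Lemma arcs_outside_le y w : y \in Y -> w \in r -> w \notin Y -> arcs y w <= 1.
Proof.
rewrite mem_Y => /and3P[Py Sy yr] wr; rewrite mem_Y wr andbT /arcs => wY.
have : ~~ (D y w && D w y).
  apply: contra wY => /andP[yw wy].
  by rewrite (P_arc Py yw wr) (S_arc Sy wy wr).
by case: (D y w); case: (D w y).
Qed.

(** [Y] is complete and each of its vertices can follow the end of [q] and precede its start, so [Y]
    may replace [g] on the cycle. *)
Lemma size_Y_le : size Y <= size g.
Proof.
have [y yY] := exists_Y.
case EY : Y (yY) => [|z s] // _.
have zY : z \in Y by rewrite EY mem_head.
have lY : last z s \in Y by rewrite EY mem_last.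
have [_ lz _] := Y_tight zY; have [lx _ _] := Y_tight lY.
have ps : path D z s.
  apply: complete_path; last by rewrite -EY uniq_Y.
  by move=> a b; rewrite -EY; apply: Y_complete.
have cyc : cycle D (x :: q ++ z :: s).
  by rewrite /= rcons_cat cat_path theta_path /= lz rcons_path ps lx.
have unq : uniq (x :: q ++ z :: s).
  rewrite -cat_cons cat_uniq -EY uniq_Y andbT; apply/andP; split.
    by have := theta_uniqC; rewrite -cat_cons cat_uniq => /andP[].
  apply/hasPn => w; rewrite mem_Y => /and3P[_ _]; rewrite mem_r -cat_cons mem_cat.
  by rewrite negb_or => /andP[].
have := longest cyc unq; rewrite -size_m -EY /= !size_cat.
by move: (size q) (size g) (size Y); clear; lia.
Qed.

(** [y] and [v] have the same degree, but only [v] has arcs to [g], namely [2 * (size g - 1)], so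
    [y] has that many more arcs to [r] than [v]. Only the vertices of [Y] other than [y] can supply
    the surplus, at most 2 each, whence [size Y >= size g]. Equality splits the two arcs at any
    other [w] evenly between [v] and [y]. *)
Lemma Y_count y v : y \in Y -> v \in g ->
  size Y = size g /\ {in r, forall w, w \notin Y -> arcs y w = 1}.
Proof.
move=> yY vg; have [[e1 e2 e3 e4 e5] e6] := meyniel_equality vg yY.
have dv := degree_split v; have dy := degree_split y.
have yr : y \in r by move: yY; rewrite mem_Y => /and3P[].
rewrite adj_Y_g // addn0 in dy.
have diff : adj y r = adj v r + 2 * (size g).-1.
  by move: e1 e2 e3 e4 e5; rewrite dv dy; clear; lia.
have sumY : \sum_(w <- r) ((w \in Y) && (w != y)) = (size Y).-1.
  rewrite -(size_rem yY) -sum1_size -big_mkcond /= -big_filter; apply: perm_big.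
  apply: uniq_perm; [exact: filter_uniq uniq_r | exact: rem_uniq uniq_Y |].
  move=> w; rewrite mem_filter (mem_rem_uniq _ uniq_Y) inE mem_Y.
  by case: (w \in r); rewrite ?andbT ?andbF // andbC.
have le w : w \in r -> arcs y w <= arcs v w + 2 * ((w \in Y) && (w != y)).
  move=> wr; have := arcs_outside vg yY wr.
  have [wY|wY] := boolP (w \in Y).
    by rewrite /arcs !(Y_nonadj vg wY) /=; case: (w != y); lia.
  have := arcs_outside_le yY wr wY.
  by have -> : w != y; [apply: contraNneq wY => -> | rewrite addn0; lia].
have leY := size_Y_le.
have le_sum : \sum_(w <- r) arcs y w <=
    \sum_(w <- r) (arcs v w + 2 * ((w \in Y) && (w != y))).
  by rewrite !big_seq; apply: leq_sum.
have sumE : \sum_(w <- r) (arcs v w + 2 * ((w \in Y) && (w != y))) =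
    adj v r + 2 * (size Y).-1.
  by rewrite big_split /= -big_distrr /= sumY.
have Y0 : 0 < size Y by case: (Y) yY.
have sY : size Y = size g.
  move: le_sum leY Y0; rewrite sumE -/(adj y r) diff.
  have := g_neq0; move: (size Y) (size g) (adj v r); clear; lia.
split=> // w wr wY; have := arcs_outside vg yY wr.
have := @sum_seq_eq_termwise _ r (arcs y) _ le _ w wr.
rewrite sumE -/(adj y r) diff sY leqnn => /(_ isT) -> .
have -> : w != y by apply: contraNneq wY => ->.
by rewrite (negPf wY) addn0; clear; lia.
Qed.

Lemma Y_tight_at y p1 b p2 : y \in Y -> q = p1 ++ b :: p2 ->
  D y b = ~~ D (last x p1) y.
Proof.
move=> /Y_tight[_ _ t] eq; move: t.
by rewrite eq /tight cat_path /= => /and3P[_ /eqP].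
Qed.

Lemma Y_in_r y : y \in Y -> y \in r.
Proof. by rewrite mem_Y => /and3P[]. Qed.

Lemma Y_degree y : y \in Y -> [/\ degree D y = 2 * n - 1, outdeg D y <= n & indeg D y <= n].
Proof.
move=> yY; have [v vg] := exists_g; have [[_ _ _ _ e] _] := meyniel_equality vg yY.
have := out y; have := ind y; move: e; rewrite /degree.
by move: (outdeg _ _) (indeg _ _) => a b; split; lia.
Qed.

(* Otherwise the out-neighbours of [w] are all out-neighbours of [y], and [w] and
   [x] are two more. *)
Lemma no_out_of_Y y w : y \in Y -> w \in r -> w \notin Y -> D y w = false.
Proof.
move=> yY wr wY; apply/negP => yw; have [v vg] := exists_g.
have [Py Sy yr] : [/\ P y, S y & y \in r] by move: yY; rewrite mem_Y => /and3P.
have [_ one] := Y_count yY vg.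
have Pw : P w by apply: P_arc yw wr.
have NSw : ~~ S w by apply: contra wY => Sw; rewrite mem_Y Pw Sw.
have xw : x != w by apply: contraTneq wr => <-; rewrite mem_r mem_head.
have yw' : y != w by apply: contraNneq wY => <-.
have [yx ly _] := Y_tight yY.
have sub : out_nbr D w \subset (out_nbr D y :\ w) :\ x.
  apply/subsetP => z; rewrite !inE => wz.
  have zx : z != x by apply: contraNneq NSw => zx; apply: S_head; rewrite -?zx.
  have zw : z != w by apply: contraTneq wz => ->; rewrite irr.
  rewrite zx zw /=; have [zr|] := boolP (z \in r).
    have Pz : P z by apply: P_arc wz zr.
    have NSz : ~~ S z by apply: contra NSw => Sz; apply: S_arc wz wr.
    have zY : z \notin Y by rewrite mem_Y (negPf NSz) andbF.
    have := one z zr zY; rewrite /arcs; case: (D y z) => //.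
    case zy : (D z y) => // _; case/negP: NSz; exact: S_arc zy zr.
  rewrite mem_r negbK inE (negPf zx) mem_cat /= => /orP[zq|zg].
    have [p1 [p2 eq]] := mem_cat_split zq.
    rewrite (Y_tight_at yY eq); apply/negP => ay.
    apply: (insert_outside (w := y) (t := [:: w]) eq) => /=.
    - by rewrite ay yw wz.
    - by rewrite inE yw'.
    by move=> a; rewrite !inE => /orP[] /eqP ->; rewrite -mem_r.
  by rewrite (shortcut_P wr zg Pw) in wz.
have [_ oy _] := Y_degree yY; have := out w.
have := subset_leq_card sub; move: oy; rewrite /outdeg.
rewrite (cardsD1 w (out_nbr D y)) inE yw (cardsD1 x (out_nbr D y :\ w)) !inE xw yx.
by clear -n_ge3; lia.
Qed.

Lemma path_successor (z a : V) (p : seq V) : z \in a :: p -> z != last a p ->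
  exists p1 b p2, p = p1 ++ b :: p2 /\ last a p1 = z.
Proof.
elim: p a => [|b p IH] a /=; first by rewrite inE => /eqP ->; rewrite eqxx.
rewrite inE => /orP[/eqP -> _|zp zl]; first by exists [::], b, p.
by have [p1 [c [p2 [-> l1]]]] := IH b zp zl; exists (b :: p1), c, p2.
Qed.

(** The mirror argument: the in-neighbours of [w] would all be in-neighbours of [y], which has two
    more, [w] itself and the end of [q]; but [y] has at most [n]. *)
Lemma no_into_Y y w : y \in Y -> w \in r -> w \notin Y -> D w y = false.
Proof.
move=> yY wr wY; apply/negP => wy; have [v vg] := exists_g.
have [Py Sy yr] : [/\ P y, S y & y \in r] by move: yY; rewrite mem_Y => /and3P.
have [_ one] := Y_count yY vg.
have Sw : S w by apply: S_arc wy wr.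
have NPw : ~~ P w by apply: contra wY => Pw; rewrite mem_Y Pw Sw.
have lw : last x q != w.
  by apply: contraTneq wr => <-; rewrite mem_r negbK -cat_cons mem_cat mem_last.
have yw' : w != y by apply: contraNneq wY => ->.
have [yx ly _] := Y_tight yY.
have sub : in_nbr D w \subset (in_nbr D y :\ w) :\ last x q.
  apply/subsetP => z; rewrite !inE => zw.
  have zl : z != last x q.
    by apply: contraNneq NPw => zl; apply: P_last; rewrite -?zl.
  have zw' : z != w by apply: contraTneq zw => ->; rewrite irr.
  rewrite zl zw' /=; have [zr|] := boolP (z \in r).
    have Sz : S z by apply: S_arc zw zr.
    have NPz : ~~ P z by apply: contra NPw => Pz; apply: P_arc zw wr.
    have zY : z \notin Y by rewrite mem_Y (negPf NPz).
    have := one z zr zY; rewrite /arcs; case: (D z y) => //.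
    by case yz : (D y z) => // _; case/negP: NPz; apply: P_arc yz zr.
  rewrite mem_r negbK -cat_cons mem_cat => /orP[zq|zg].
    have [p1 [b [p2 [eq lz]]]] := path_successor zq zl.
    apply: contraT => Nzy; exfalso.
    have yb : D y b by rewrite (Y_tight_at yY eq) lz.
    apply: (insert_outside (w := w) (t := [:: y]) eq) => /=.
    - by rewrite lz zw wy yb.
    - by rewrite inE yw'.
    by move=> a; rewrite !inE => /orP[] /eqP ->; rewrite -mem_r.
  by rewrite (shortcut_S wr zg Sw) in zw.
have [_ _ iy] := Y_degree yY; have := ind w.
have := subset_leq_card sub; move: iy; rewrite /indeg.
rewrite (cardsD1 w (in_nbr D y)) inE wy (cardsD1 (last x q) (in_nbr D y :\ w)) !inE lw ly.
by clear -n_ge3; lia.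
Qed.

Lemma r_eq_Y w : w \in r -> w \in Y.
Proof.
move=> wr; apply: contraT => wY; have [y yY] := exists_Y; have [v vg] := exists_g.
have [_ one] := Y_count yY vg; have := one w wr wY.
by rewrite /arcs no_out_of_Y // no_into_Y.
Qed.

Lemma theta_two_blobs : exists Y, two_blobs n D x q g Y.
Proof.
exists Y; have [y yY] := exists_Y; have [v vg] := exists_g.
have pY : perm_eq (x :: q ++ g ++ Y) (enum V).
  rewrite catA -cat_cons; apply: perm_trans perm_C_r; rewrite perm_cat2l.
  apply: uniq_perm; [exact: uniq_Y | exact: uniq_r |] => w.
  by apply/idP/idP; [apply: Y_in_r | apply: r_eq_Y].
split.
- by rewrite (perm_uniq pY) enum_uniq.
- by move=> z; rewrite (perm_mem pY) mem_enum.
- exact: theta_path.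
- by case: th => _ _ _ _ /andP[].
- exact: g_neq0.
- by have [] := Y_count yY vg.
- exact: g_complete.
- exact: Y_complete.
- by move=> a b ag bY; rewrite !(Y_nonadj ag bY).
- by move=> z; rewrite mem_cat => /orP[/g_tight[]|/Y_tight[]].
- by move=> z; rewrite mem_cat => /orP[/g_tight[]|/Y_tight[]].
- by move=> z; rewrite mem_cat => /orP[/g_tight[]|/Y_tight[]].
- move=> z; rewrite mem_cat => /orP[zg|/Y_degree[] //].
  by have [[]] := meyniel_equality zg yY.
by rewrite size_m.
Qed.

End Meyniel.

(** * Two complete blobs *)

(** The order is [y, x, q, v]. Both blob vertices dominate [x] and are dominated by the end of [q],
    so either can take the place of the other. *)
Lemma single_blob_interlaced n (V : finType) (D : rel V) x q G Y :
  #|V| = 2 * n -> 3 <= n -> two_blobs n D x q G Y -> size G = 1 ->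
  exists p, interlaced D n.-1 p.
Proof.
move=> cardV n3 [uq cov pq q0 _ eYG _ _ _ hd lst _ _ _] G1; rewrite G1 in eYG.
case: G G1 uq cov hd lst => [|v []] // _; case: Y eYG => [|y []] // _.
move=> uq cov hd lst; pose s := y :: (x :: q) ++ [:: v].
have [yx vx] : D y x /\ D v x by split; apply: hd; rewrite !inE eqxx ?orbT.
have [ly lv] : D (last x q) y /\ D (last x q) v.
  by split; apply: lst; rewrite !inE eqxx ?orbT.
have ps : perm_eq s (x :: q ++ [:: v] ++ [:: y]).
  by apply/permP => a; rewrite /s /= !count_cat /=; clear; lia.
have us : uniq s by rewrite (perm_uniq ps).
have sV z : z \in s by rewrite (perm_mem ps).
have size_s : size s = 2 * n.
  rewrite -cardV cardE; apply/perm_size/uniq_perm; rewrite ?enum_uniq //.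
  by move=> z; rewrite sV mem_enum.
have kE : 2 * n.-1 = size (x :: q).
  by move: size_s; rewrite /s /= size_cat /=; lia.
have nE : 2 * n.-1 + 2 = size s by rewrite size_s; lia.
exists (nth y s); rewrite /interlaced nE; split.
- by move=> z; exists (index z s); rewrite ?index_mem ?nth_index.
- by move=> i j si sj /eqP; rewrite nth_uniq // => /eqP.
- move=> i ik; have : path D y (x :: q ++ [:: v]) by rewrite /= cat_path yx pq /= lv.
  move/(pathP y)/(_ i); apply; rewrite /= size_cat /=.
  by move: ik; rewrite kE /=; lia.
- rewrite kE /=; have -> : nth y (x :: q ++ [:: v]) (size q) = last x q.
    by rewrite -cat_cons nth_cat /= ltnSn (last_nth y).
  exact: ly.
by rewrite kE /= nth_cat ltnn subnn.
Qed.

Lemma two_blobs_swap n (V : finType) (D : rel V) x q G Y :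
  two_blobs n D x q G Y -> two_blobs n D x q Y G.
Proof.
case=> uq cov pq q0 G0 eYG cG cY non hd lst tg dg lg.
have pYG : perm_eq (x :: q ++ Y ++ G) (x :: q ++ G ++ Y).
  by rewrite perm_cons perm_cat2l perm_catC.
have memYG z : z \in Y ++ G -> z \in G ++ Y by rewrite !mem_cat orbC.
split=> //.
- by rewrite (perm_uniq pYG).
- by move=> z; rewrite (perm_mem pYG).
- by rewrite eYG.
- by move=> a b aY bG; rewrite !(non b a bG aY).
- by move=> z /memYG /hd.
- by move=> z /memYG /lst.
- by move=> z /memYG /tg.
- by move=> z /memYG /dg.
by move: lg; rewrite /= !size_cat eYG.
Qed.

Lemma tight_at (V : finType) (D : rel V) v x q s1 a b s2 :
  tight D v x q -> x :: q = s1 ++ a :: b :: s2 -> D v b = ~~ D a v.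
Proof.
case: s1 => [|z s1] t [ex eq]; move: t; rewrite /tight eq -?ex.
  by move=> /andP[/eqP].
by rewrite cat_path /= => /and3P[_ _ /andP[/eqP]].
Qed.

Lemma complete_order (V : finType) (D : rel V) (A : seq V) a b :
  {in A &, forall y z, y != z -> D y z} -> uniq A -> a \in A -> b \in A -> a != b ->
  exists2 t, perm_eq (a :: rcons t b) A & path D a (rcons t b).
Proof.
move=> compl uA aA bA ab; pose t := rem b (rem a A).
have pA : perm_eq (a :: rcons t b) A.
  rewrite perm_sym; apply: perm_trans (perm_to_rem aA) _; rewrite perm_cons.
  have b' : b \in rem a A by rewrite mem_rem_uniq // inE eq_sym ab.
  by rewrite perm_sym perm_rcons perm_sym perm_to_rem.
exists t => //; apply: complete_path; last by rewrite (perm_uniq pA).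
by move=> y z; rewrite !(perm_mem pA); apply: compl.
Qed.

(** * Blobs with at least two vertices *)

Section LargeBlobs.

Variables (n : nat) (V : finType) (D : rel V).
Hypothesis irr : irreflexive D.
Hypothesis cardV : #|V| = 2 * n.
Hypothesis n_ge3 : 3 <= n.
Hypothesis out : forall z, n - 1 <= outdeg D z.
Hypothesis ind : forall z, n - 1 <= indeg D z.
Variables (x : V) (q : seq V).

Lemma blobs_count G Y : two_blobs n D x q G Y -> size q + 2 * size G = 2 * n - 1.
Proof.
move=> tb; have : size (x :: q ++ G ++ Y) = 2 * n.
  rewrite -cardV cardE; apply/perm_size/uniq_perm; rewrite ?enum_uniq //.
    exact: (blobs_uniq tb).
  by move=> z; rewrite (blobs_cover tb) mem_enum.
by rewrite /= !size_cat (blobs_size tb); clear; lia.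
Qed.

Lemma blobs_uniqY G Y : two_blobs n D x q G Y -> uniq Y.
Proof. by move/blobs_uniq; rewrite catA -cat_cons cat_uniq => /and3P[]. Qed.

Lemma blobs_uniqG G Y : two_blobs n D x q G Y -> uniq G.
Proof. by move/two_blobs_swap/blobs_uniqY. Qed.

Lemma blobs_cycle G Y : two_blobs n D x q G Y -> cycle D (x :: q ++ G).
Proof.
move=> tb; rewrite /= rcons_cat cat_path (blobs_path tb) /=.
case EG : G (blobs_G tb) => [|a t] //= _.
have inG z : z \in G -> z \in G ++ Y by rewrite mem_cat => ->.
rewrite (blobs_last tb) ?inG ?EG ?mem_head //= rcons_path.
rewrite (blobs_head tb) ?inG ?EG ?mem_last // andbT.
apply: complete_path; last by rewrite -EG (blobs_uniqG tb).
by move=> b c; rewrite -EG; apply: (blobs_complG tb).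
Qed.

Lemma blobs_other (A : seq V) y : uniq A -> 1 < size A -> y \in A ->
  exists2 y', y' \in A & y' != y.
Proof.
move=> uA A1 yA; have : rem y A != [::].
  by rewrite -size_eq0 size_rem //; case: (size A) A1 => [|[]].
case E : (rem y A) => [|y' t] // _; exists y'.
  by apply: (mem_rem (x := y)); rewrite E mem_head.
have : y' \in rem y A by rewrite E mem_head.
by rewrite mem_rem_uniq // inE => /andP[].
Qed.

(** If [z] does not dominate [y], then [y -> c]. For another vertex [y'] of [Y], either [a -> y']
    and all of [Y], from [y'] to [y], replaces [z], or [y' -> z] and all of [Y], from [y] to [y'],
    is inserted between [a] and [z]. As [Y] has at least two vertices, both cycles are too long. *)
Lemma no_descent G Y s1 a z c s2 y : 1 < size G ->
  two_blobs n D x q G Y -> x :: q = s1 ++ a :: z :: c :: s2 -> y \in Y ->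
  D a y -> D z y.
Proof.
move=> G1 tb eq yY ay; apply: contraT => Nzy; exfalso.
have inY w : w \in Y -> w \in G ++ Y by rewrite mem_cat orbC => ->.
have uY := blobs_uniqY tb.
have yc : D y c.
  have eq' : x :: q = rcons s1 a ++ z :: c :: s2 by rewrite cat_rcons.
  by rewrite (tight_at (blobs_tight tb (inY y yY)) eq').
have [|y' y'Y y'y] := blobs_other uY _ yY; first by rewrite (blobs_size tb).
have cyc := blobs_cycle tb; rewrite -cat_cons eq in cyc.
have uq := blobs_uniq tb; rewrite -cat_cons eq in uq.
have szY := blobs_size tb; have longest := blobs_longest tb.
have [ay'|Nay'] := boolP (D a y').
  have [t pt ppt] := complete_order (blobs_complY tb) uY y'Y yY y'y.
  have cyc1 : cycle D (s1 ++ a :: (y' :: rcons t y) ++ c :: s2 ++ G).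
    apply: (cycle_replace (t := [:: z])); first by rewrite -catA in cyc.
    by rewrite /= ay' rcons_path ppt last_rcons yc.
  have perm1 : perm_eq (z :: s1 ++ a :: (y' :: rcons t y) ++ c :: s2 ++ G)
      ((s1 ++ [:: a, z, c & s2]) ++ G ++ Y).
    apply/permP => f; rewrite /= !count_cat /= !count_cat /= !count_cat.
    by have /permP/(_ f) := pt; rewrite /=; clear; lia.
  have := longest _ cyc1; rewrite -(perm_uniq perm1) /= in uq.
  case/andP: uq => _ uq /(_ uq).
  have := perm_size perm1; rewrite -[x :: q ++ G]cat_cons eq /= !size_cat /= ?size_cat szY.
  by move: G1; clear; lia.
have y'z : D y' z.
  by rewrite (tight_at (blobs_tight tb (inY y' y'Y)) eq).
rewrite eq_sym in y'y.
have [t pt ppt] := complete_order (blobs_complY tb) uY yY y'Y y'y.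
have cyc1 : cycle D (s1 ++ a :: (y :: rcons t y') ++ z :: (c :: s2) ++ G).
  apply: (cycle_replace (t := [::])); first by rewrite -catA in cyc.
  by rewrite /= ay rcons_path ppt last_rcons y'z.
have perm1 : perm_eq (s1 ++ a :: (y :: rcons t y') ++ z :: (c :: s2) ++ G)
    ((s1 ++ [:: a, z, c & s2]) ++ G ++ Y).
  apply/permP => f; rewrite /= !count_cat /= !count_cat /= !count_cat.
  by have /permP/(_ f) := pt; rewrite /=; clear; lia.
have := longest _ cyc1; rewrite (perm_uniq perm1) => /(_ uq).
rewrite (perm_size perm1) -[x :: q ++ G]cat_cons eq /= !size_cat /= ?size_cat szY.
by move: G1; clear; lia.
Qed.

Lemma blobs_indeg G Y y : two_blobs n D x q G Y -> y \in Y -> indeg D y <= n.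
Proof.
move=> tb yY; have yGY : y \in G ++ Y by rewrite mem_cat yY orbT.
have := blobs_degree tb yGY; have := out y; rewrite /degree; lia.
Qed.

(** Otherwise, in the absence of descents, only the last vertex of [x :: q] dominates [y], whose
    in-degree is then at most [size Y]. But [size q >= 2] gives [size Y <= n - 2]. *)
Lemma last_arc G Y p l y : 1 < size G -> two_blobs n D x q G Y ->
  q = rcons p l -> p != [::] -> y \in Y -> D (last x p) y.
Proof.
move=> G1 tb eq p0 yY; apply: contraT => Nby; exfalso.
have sq : size q = (size p).+1 by rewrite eq size_rcons.
have none i : i < size q -> D (nth x (x :: q) i) y = false.
  move=> iq; apply/negP => iy.
  have Nb : ~~ D (nth x (x :: q) (size p)) y.
    rewrite (_ : nth x (x :: q) (size p) = last x p) //.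
    by rewrite eq (last_nth x) -rcons_cons nth_rcons /= ltnSn.
  have ip : i < size p.
    rewrite ltn_neqAle -ltnS -sq iq andbT; apply: contraNneq Nb => <-; exact: iy.
  have [j jP /andP[jy Njy]] :=
    descent_between (P := fun j => D (nth x (x :: q) j) y) ip iy Nb.
  have split3 : x :: q = take j (x :: q) ++ [:: nth x (x :: q) j,
      nth x (x :: q) j.+1, nth x (x :: q) j.+2 & drop j.+3 (x :: q)].
    by rewrite -!drop_nth ?cat_take_drop //= sq; move: jP; clear; lia.
  by case/negP: Njy; apply: (no_descent G1 tb split3 yY).
have sub : in_nbr D y \subset [set z in last x q :: rem y Y].
  apply/subsetP => z; rewrite !inE => zy.
  have := blobs_cover tb z; rewrite -cat_cons !mem_cat.
  case/or3P=> [zq|zG|zY].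
  - have := zq; rewrite -index_mem => iq; move: zy; rewrite -(nth_index x zq).
    have [lt|ge] := ltnP (index z (x :: q)) (size q); first by rewrite none.
    have -> : index z (x :: q) = size q by move: iq ge => /=; clear; lia.
    by rewrite -(last_nth x) eqxx.
  - by rewrite (blobs_nonadj tb zG yY) in zy.
  rewrite mem_rem_uniq ?(blobs_uniqY tb) // !inE zY andbT orbC.
  by have [e|] := eqVneq z y; first by rewrite e irr in zy.
have := subset_leq_card sub; rewrite [X in _ <= X]cardsE => le.
have := leq_trans (ind y) (leq_trans le (card_size _)).
rewrite /= size_rem // (blobs_size tb).
have := blobs_count tb; rewrite sq.
have p1 : 0 < size p by case: (p) p0.
by move: (size G) (size p) p1 G1; clear; lia.
Qed.

(** For [q = rcons p l] with [p] nonempty no vertex of a blob dominates [l], and every in-neighbour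
    of [l] dominates a fixed [y]. With [l] and the rest of [Y] this gives [y] in-degree at least
    [n + 1], one too many. *)
Lemma large_blobs_path G Y : 1 < size G -> two_blobs n D x q G Y -> size q = 1.
Proof.
move=> G1 tb; have tb' := two_blobs_swap tb.
have Y1 : 1 < size Y by rewrite (blobs_size tb).
case/lastP E : q (blobs_q tb) => [|p l] // _; rewrite size_rcons; congr _.+1.
apply/eqP; rewrite size_eq0; apply: contraT => p0; exfalso.
have lastE : last x q = l by rewrite E last_rcons.
have [y yY] : exists y, y \in Y.
  by case: (Y) Y1 => // y t _; exists y; rewrite mem_head.
have eq : x :: q = belast x p ++ [:: last x p; l].
  by rewrite E -rcons_cons lastI -cats1 cat_rcons.
have inY w : w \in Y -> w \in G ++ Y by rewrite mem_cat orbC => ->.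
have inG w : w \in G -> w \in G ++ Y by rewrite mem_cat => ->.
have uY := blobs_uniqY tb; have uG := blobs_uniqG tb.
have NYl w : w \in Y -> D w l = false.
  move=> wY; rewrite (tight_at (blobs_tight tb (inY w wY)) eq).
  by rewrite (last_arc G1 tb E).
have NGl w : w \in G -> D w l = false.
  move=> wG; rewrite (tight_at (blobs_tight tb (inG w wG)) eq).
  by rewrite (last_arc Y1 tb' E).
have uq := blobs_uniq tb.
have in_l z : D z l -> D z y /\ z \in x :: q.
  move=> zl; have := blobs_cover tb z; rewrite -cat_cons !mem_cat.
  case/or3P=> [zq|zG|zY]; last 2 first.
  - by rewrite NGl in zl.
  - by rewrite NYl in zl.
  split=> //; apply: contraT => Nzy; exfalso.
  have z_last : z != last x q.
    by rewrite lastE; apply: contraTneq zl => ->; rewrite irr.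
  have [p1 [c [p2 [eq2 lz]]]] := path_successor zq z_last.
  case/lastP: p2 eq2 => [|s2 l'] eq2.
    move: Nzy; rewrite -lz; have := eq2; rewrite E cats1 => /rcons_inj[<- _].
    by rewrite (last_arc G1 tb E).
  have [ep el] : p = p1 ++ c :: s2 /\ l' = l.
    by move: eq2; rewrite E -rcons_cons -rcons_cat => /rcons_inj[].
  have b_eq : last c s2 = last x p by rewrite ep last_cat.
  have eqz : x :: q = belast x p1 ++ z :: c :: rcons s2 l.
    by rewrite eq2 el -cat_cons lastI cat_rcons lz.
  have yc : D y c by rewrite (tight_at (blobs_tight tb (inY y yY)) eqz).
  have [|y' y'Y y'y] := blobs_other uY _ yY; first by [].
  have [t pt ppt] := complete_order (blobs_complY tb) uY y'Y yY y'y.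
  have [g gG] : exists g, g \in G.
    by case: (G) G1 => // g t' _; exists g; rewrite mem_head.
  have [g' g'G g'g] := blobs_other uG G1 gG.
  have [t' pt' ppt'] := complete_order (blobs_complG tb) uG g'G gG g'g.
  have := blobs_path tb; rewrite eq2 el cat_path /= rcons_path.
  case/and4P=> pp1 _ ps2 _.
  (* This cycle takes in both blobs: from [l] through [Y] to [c], along [q] to the vertex before
     [l], through [G] to [x], and along [q] to [z], which dominates [l]. *)
  have cyc : cycle D (l :: (y' :: rcons t y) ++ (c :: s2) ++ (g' :: rcons t' g) ++ x :: p1).
    have pA : path D l (y' :: rcons t y).
      by rewrite /= ppt -lastE (blobs_last tb) ?inY.
    have lA : last l (y' :: rcons t y) = y by rewrite /= last_rcons.
    have pB : path D y (c :: s2) by rewrite /= yc ps2.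
    have lB : last y (c :: s2) = last x p by [].
    have pC : path D (last x p) (g' :: rcons t' g).
      by rewrite /= ppt' (last_arc Y1 tb' E).
    have lC : last (last x p) (g' :: rcons t' g) = g by rewrite /= last_rcons.
    have pE : path D g (rcons (x :: p1) l).
      by rewrite /= rcons_path pp1 lz zl (blobs_head tb) ?inG.
    rewrite -[cycle _ _]/(path D l (rcons (_ ++ _ ++ _ ++ _) l)).
    by rewrite !rcons_cat cat_path pA lA cat_path pB lB cat_path pC lC pE.
  have perm1 : perm_eq (l :: (y' :: rcons t y) ++ (c :: s2) ++ (g' :: rcons t' g) ++ x :: p1)
      (x :: q ++ G ++ Y).
    apply/permP => f; rewrite eq2 el -(cats1 s2) /= !count_cat /= !count_cat /= !count_cat /=.
    by have /permP/(_ f) := pt; have /permP/(_ f) := pt'; rewrite /=; clear; lia.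
  have := blobs_longest tb cyc; rewrite (perm_uniq perm1) => /(_ uq).
  by rewrite (perm_size perm1) /= !size_cat; move: Y1; clear; lia.
have sub : [set z in rem y Y] :|: (l |: in_nbr D l) \subset in_nbr D y.
  apply/subsetP => z; rewrite !inE => /or3P[|/eqP ->|/in_l[] //].
    rewrite mem_rem_uniq // inE => /andP[zy zY].
    by apply: (blobs_complY tb).
  by rewrite -lastE (blobs_last tb) ?inY.
have disj : [disjoint [set z in rem y Y] & l |: in_nbr D l].
  rewrite disjoint_subset; apply/subsetP => z; rewrite !inE => /mem_rem zY.
  have zq : z \notin x :: q.
    move: uq; rewrite catA -cat_cons cat_uniq => /and3P[_ /hasPn/(_ z zY) h _].
    by apply: contra h; rewrite -cat_cons mem_cat => ->.
  rewrite negb_or; apply/andP; split; last first.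
    by apply: contra zq => /in_l[].
  by apply: contraNneq zq => ->; rewrite -lastE mem_last.
have card_rem : #|[set z in rem y Y]| = (size Y).-1.
  by rewrite cardsE (card_uniqP (rem_uniq _ uY)) size_rem.
have := subset_leq_card sub; rewrite cardsU disjoint_setI0 // cards0 subn0.
rewrite cardsU1 [l \in _]inE irr card_rem.
have := blobs_indeg tb yY; have := ind l; rewrite /indeg.
by move: Y1 n_ge3; clear; lia.
Qed.

End LargeBlobs.

(** * Recognition of [H(2n)] and [H'(2n)] *)

Section H2nIso.

Variables (n : nat) (V : finType) (D : rel V).
Hypothesis irr : irreflexive D.
Hypothesis cardV : #|V| = 2 * n.
Hypothesis n_ge3 : 3 <= n.
Hypothesis out : forall z, n - 1 <= outdeg D z.
Hypothesis ind : forall z, n - 1 <= indeg D z.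
Variables (x l : V).

(** If [x] dominates [y] but not [y'], tightness gives [y' -> l], and all of [Y] fits between [x]
    and [l] on the cycle. *)
Lemma blobs_const G Y : 1 < size G -> two_blobs n D x [:: l] G Y ->
  {in Y &, forall y y', D x y -> D x y'}.
Proof.
move=> G1 tb y y' yY y'Y xy; apply: contraT => Nxy'; exfalso.
have inY w : w \in Y -> w \in G ++ Y by rewrite mem_cat orbC => ->.
have uY := blobs_uniqY tb.
have yy' : y != y' by apply: contraNneq Nxy' => <-.
have [t pt ppt] := complete_order (blobs_complY tb) uY yY y'Y yy'.
have y'l : D y' l by have := blobs_tight tb (inY y' y'Y); rewrite /tight /= Nxy' andbT => /eqP.
have cyc1 : cycle D ([::] ++ x :: (y :: rcons t y') ++ l :: G).
  apply: (cycle_replace (t := [::])); first exact: (blobs_cycle tb).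
  by rewrite /= xy rcons_path ppt last_rcons y'l.
have perm1 : perm_eq (x :: (y :: rcons t y') ++ l :: G) (x :: [:: l] ++ G ++ Y).
  apply/permP => f; rewrite /= !count_cat /=.
  by have /permP/(_ f) := pt; rewrite /=; clear; lia.
have := blobs_longest tb cyc1; rewrite /= -/(uniq (x :: (y :: rcons t y') ++ l :: G)).
rewrite (perm_uniq perm1) (blobs_uniq tb) => /(_ isT).
have := perm_size perm1; rewrite /= !size_cat /= (blobs_size tb).
by move: G1; clear; lia.
Qed.

(** [Y] plays the part of [A], [G] that of [B], and [l] that of the special vertex [y] of [H(2n)].
    Only the arc from [l] to [x] is undetermined, and it separates [H(2n)] from [H'(2n)]. *)
Lemma two_blobs_iso G Y : two_blobs n D x [:: l] G Y -> size G = n.-1 ->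
  (forall y, y \in Y -> D x y) -> (forall v, v \in G -> ~~ D x v) ->
  diso D (H2n n) \/ diso D (H2n' n).
Proof.
move=> tb sG xY NxG; have sY := blobs_size tb; rewrite sG in sY.
have inY w : w \in Y -> w \in G ++ Y by rewrite mem_cat orbC => ->.
have inG w : w \in G -> w \in G ++ Y by rewrite mem_cat => ->.
have uY := blobs_uniqY tb; have uG := blobs_uniqG tb.
pose f (w : H2n_vertex n) : V := match w with
  | inl (inl i) => nth x Y i | inl (inr i) => nth x G i
  | inr true => x | inr false => l end.
have nthY (i : 'I_n.-1) : nth x Y i \in Y by rewrite mem_nth ?sY.
have nthG (i : 'I_n.-1) : nth x G i \in G by rewrite mem_nth ?sG.
have Yl y : y \in Y -> D y l = false.
  move=> yY; have := blobs_tight tb (inY y yY).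
  by rewrite /tight /= xY // andbT => /eqP.
have Gl v : v \in G -> D v l.
  move=> vG; have := blobs_tight tb (inG v vG).
  by rewrite /tight /= NxG // andbT => /eqP.
have xl : D x l by have := blobs_path tb; rewrite /= andbT.
have f_surj z : exists w, f w = z.
  have := blobs_cover tb z; rewrite inE mem_cat inE mem_cat.
  case/or4P=> [/eqP ->|/eqP ->|zG|zY].
  - by exists (inr true).
  - by exists (inr false).
  - have iz : index z G < n.-1 by rewrite -sG index_mem.
    by exists (inl (inr (Ordinal iz))); rewrite /= nth_index.
  have iz : index z Y < n.-1 by rewrite -sY index_mem.
  by exists (inl (inl (Ordinal iz))); rewrite /= nth_index.
have f_bij : bijective f.
  have f_onto : f @: [set: H2n_vertex n] = [set: V].
    by apply/setP => z; rewrite inE; have [w <-] := f_surj z; rewrite imset_f ?inE.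
  have cardW : #|H2n_vertex n| = #|V|.
    by rewrite cardV !card_sum !card_ord card_bool; clear -n_ge3; lia.
  apply: inj_card_bij; last by rewrite cardW.
  have inj : {in [set: H2n_vertex n] &, injective f}.
    by apply/imset_injP; rewrite f_onto !cardsT cardW.
  by move=> w w' e; apply: inj; rewrite ?inE.
have compl (A : seq V) (i j : 'I_n.-1) : size A = n.-1 -> uniq A ->
    {in A &, forall a b, a != b -> D a b} -> D (nth x A i) (nth x A j) = (i != j).
  move=> sA uA cA; have [->|ij] := eqVneq i j; first by rewrite irr.
  by apply: cA; rewrite ?mem_nth ?sA // nth_uniq ?sA.
have arcsE w w' : ~~ ((w == inr false) && (w' == inr true)) ->
    D (f w) (f w') = H2n n w w'.
  have hd z : z \in G ++ Y -> D z x := blobs_head tb (z := z).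
  have lst z : z \in G ++ Y -> D l z := blobs_last tb (z := z).
  case: w => [[i|i]|[]]; case: w' => [[j|j]|[]] //= _.
  - by apply: compl => //; apply: blobs_complY tb.
  - by rewrite (blobs_nonadj tb (nthG j) (nthY i)).
  - by rewrite hd ?inY.
  - by rewrite Yl.
  - by rewrite (blobs_nonadj tb (nthG i) (nthY j)).
  - by apply: compl => //; apply: blobs_complG tb.
  - by rewrite hd ?inG.
  - by rewrite Gl.
  - by rewrite xY.
  - by apply/negbTE/NxG.
  - by rewrite lst ?inY.
  by rewrite lst ?inG.
have [lx|lx] := boolP (D l x); [right | left]; apply: (diso_of_bij f_bij) => w w'.
  rewrite /H2n'; have [/andP[/eqP -> /eqP ->]|N] := boolP (_ && _).
    by rewrite orbT.
  by rewrite arcsE // orbF.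
have [/andP[/eqP -> /eqP ->]|N] := boolP ((w == inr false) && (w' == inr true)).
  exact: negbTE.
exact: arcsE.
Qed.

(** [x] dominates exactly one blob. If it dominated both, tightness would leave [x] as the only
    in-neighbour of [l]; if neither, [l] would be its only out-neighbour. Both contradict the
    semi-degree bound [n - 1 >= 2]. *)
Lemma large_blobs_iso G Y : 1 < size G -> two_blobs n D x [:: l] G Y ->
  diso D (H2n n) \/ diso D (H2n' n).
Proof.
move=> G1 tb; have tb' := two_blobs_swap tb.
have Y1 : 1 < size Y by rewrite (blobs_size tb).
have sG : size G = n.-1.
  by have := blobs_count cardV tb; rewrite /=; move: n_ge3; clear; lia.
have sY : size Y = n.-1 by rewrite (blobs_size tb).
have [y yY] : exists y, y \in Y.
  by case: (Y) Y1 => // y t _; exists y; rewrite mem_head.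
have [v vG] : exists v, v \in G.
  by case: (G) G1 => // v t _; exists v; rewrite mem_head.
have cY := blobs_const G1 tb; have cG := blobs_const Y1 tb'.
have tightY w : w \in Y -> D w l = ~~ D x w.
  move=> wY; have wGY : w \in G ++ Y by rewrite mem_cat wY orbT.
  by have := blobs_tight tb wGY; rewrite /tight /= andbT => /eqP.
have tightG w : w \in G -> D w l = ~~ D x w.
  move=> wG; have wGY : w \in G ++ Y by rewrite mem_cat wG.
  by have := blobs_tight tb wGY; rewrite /tight /= andbT => /eqP.
have allY : D x y -> forall w, w \in Y -> D x w by move=> xy w wY; apply: cY xy.
have allG : D x v -> forall w, w \in G -> D x w by move=> xv w wG; apply: cG xv.
have NallY : ~~ D x y -> forall w, w \in Y -> ~~ D x w.
  by move=> xy w wY; apply: contra xy; apply: cY.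
have NallG : ~~ D x v -> forall w, w \in G -> ~~ D x w.
  by move=> xv w wG; apply: contra xv; apply: cG.
have [xy|xy] := boolP (D x y); have [xv|xv] := boolP (D x v).
- exfalso; have sub : in_nbr D l \subset [set x].
    apply/subsetP => z; rewrite !inE => zl; have := blobs_cover tb z.
    rewrite inE mem_cat inE mem_cat => /or4P[//|/eqP e|zG|zY].
    - by rewrite e irr in zl.
    - by rewrite (tightG z zG) (allG xv z zG) in zl.
    by rewrite (tightY z zY) (allY xy z zY) in zl.
  have := subset_leq_card sub; rewrite cards1; have := ind l; rewrite /indeg.
  by move: n_ge3; clear; lia.
- by apply: (two_blobs_iso tb sG); [apply: allY | apply: NallG].
- by apply: (two_blobs_iso tb' sY); [apply: allG | apply: NallY].
exfalso; have sub : out_nbr D x \subset [set l].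
  apply/subsetP => z; rewrite !inE => xz; have := blobs_cover tb z.
  rewrite inE mem_cat inE mem_cat => /or4P[/eqP e|//|zG|zY].
  - by rewrite e irr in xz.
  - by rewrite (negPf (NallG xv z zG)) in xz.
  by rewrite (negPf (NallY xy z zY)) in xz.
have := subset_leq_card sub; rewrite cards1; have := out x; rewrite /outdeg.
by move: n_ge3; clear; lia.
Qed.

End H2nIso.

(** * Longest cycles of strong digraphs and the case distinction *)

Lemma strong_or_closed (V : finType) (D : rel V) :
  strong D \/ exists B : {set V}, [/\ B != set0, B != setT & no_arc D B (~: B)].
Proof.
have [/existsP[B /and3P[B0 BT noB]]|none] := boolP [exists B : {set V},
    [&& B != set0, B != setT & [forall a, [forall b, (a \in B) && (b \notin B) ==> ~~ D a b]]]].
  right; exists B; split=> // a b aB; rewrite inE => bB.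
  by move/forallP/(_ a)/forallP/(_ b): noB; rewrite aB bB.
left=> A A0 AT; have [/existsP[a /existsP[b /and3P[aA bA ab]]]|no] :=
    boolP [exists a, [exists b, [&& a \in A, b \notin A & D a b]]].
  by exists a, b.
case/existsP: none; exists A; rewrite A0 AT /=.
apply/forallP => a; apply/forallP => b; apply/implyP => /andP[aA bA].
by apply: contra no => ab; apply/existsP; exists a; apply/existsP; exists b; rewrite aA bA.
Qed.

Lemma strong_cycle (V : finType) (D : rel V) (a b : V) :
  irreflexive D -> strong D -> D a b ->
  exists c, [/\ cycle D c, uniq c & 1 < size c].
Proof.
move=> irr strongD ab.
have ba : connect D b a.
  pose A := [set z | connect D b z].
  have [AT|AT] := eqVneq A setT.
    have : a \in A by rewrite AT inE.
    by rewrite inE.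
  have A0 : A != set0 by apply/set0Pn; exists b; rewrite inE connect0.
  have [u [v [uA vA uv]]] := strongD A A0 AT.
  by move: uA vA; rewrite !inE => bu /negP[]; apply: connect_trans bu (connect1 uv).
case/connectP: ba => p pp; case/shortenP: pp => p' pp' up' _ ea.
exists (b :: p'); split=> //; first by rewrite /= rcons_path pp' -ea.
by case: p' ea {pp' up'} => // e; rewrite e irr in ab.
Qed.

Lemma longest_cycle (V : finType) (D : rel V) :
  exists c, [/\ cycle D c, uniq c &
    forall c', cycle D c' -> uniq c' -> size c' <= size c].
Proof.
pose P m := [exists c : m.-tuple V, cycle D c && uniq c].
have P0 : exists m, P m by exists 0; apply/existsP; exists [tuple].
have Pb m : P m -> m <= #|V|.
  by case/existsP=> c /andP[_ uc]; rewrite -(size_tuple c) -(card_uniqP uc) max_card.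
have [m /existsP[c /andP[cc uc]] m_max] := ex_maxnP P0 Pb.
exists c; split=> // c' cc' uc'; rewrite size_tuple; apply: m_max.
by apply/existsP; exists (in_tuple c'); rewrite /= cc' uc'.
Qed.

Lemma cycle_hamiltonian (V : finType) (D : rel V) c :
  1 < size c -> cycle D c -> uniq c -> size c = #|V| -> hamiltonian D.
Proof.
move=> c1 cc uc sc; exists c; split=> //; first by rewrite /ucycle cc.
have /subset_cardP/(_ (subset_predT _)) : #|c| = #|V| by rewrite (card_uniqP uc).
by move=> e x; rewrite e inE.
Qed.

(** The cycle is read from [b], where the bypass returns, and cut at [a], where it leaves: the
    stretch from [b] to [a] is the common path and the remainder is [g]. *)
Lemma bypass_theta (V : finType) (D : rel V) (c u : seq V) a b :
  cycle D c -> uniq c -> a \in c -> b \in c -> a != b -> u != [::] ->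
  path D a (rcons u b) -> all (fun z => z \notin c) u -> uniq u ->
  exists q g, theta D b q g u /\ size (b :: q ++ g) = size c.
Proof.
move=> cc uc ac bc ab u0 pu uC uu; have [i s eqc] := rot_to bc.
have as_ : a \in s.
  by move: ac; rewrite -(mem_rot i) eqc inE (negPf ab).
have [p [g es]] := mem_cat_split as_.
have cs : cycle D (b :: s) by rewrite -eqc rot_cycle.
have us : uniq (b :: s) by rewrite -eqc rot_uniq.
exists (rcons p a), g; split; last first.
  by rewrite cat_rcons -es -eqc size_rot.
move: cs; rewrite /= es rcons_cat cat_path /= => /and3P[pp pa pg].
split.
- rewrite catA cat_rcons -es -cat_cons cat_uniq us uu andbT; apply/hasPn => z zu.
  by rewrite -eqc mem_rot; apply: (allP uC).
- by rewrite rcons_path pp.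
- by rewrite last_rcons.
- by rewrite last_rcons.
by rewrite u0 andbT; case: (p).
Qed.

Theorem theorem2 (n : nat) (V : finType) (D : rel V)
    (D_loopless : irreflexive D)
    (n_ge : 6 <= 2 * n)
    (cardV : #|V| = 2 * n)
    (min_degree : forall x : V, 2 * n - 1 <= degree D x)
    (min_semidegree : forall x : V, n - 1 <= minn (outdeg D x) (indeg D x)) :
  hamiltonian D \/
  (in_Hnn n D \/ in_Hnn11 n D) \/
  [\/ diso D (H2n n), diso D (H2n' n) |
  [\/ diso D D6, diso D D6',
      diso D (converse D6) | diso D (converse D6')]].
Proof.
have n3 : 3 <= n by lia.
have out x : n - 1 <= outdeg D x by have := min_semidegree x; rewrite leq_min => /andP[].
have ind x : n - 1 <= indeg D x by have := min_semidegree x; rewrite leq_min => /andP[].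
have [strongD|[B [B0 BT noB]]] := strong_or_closed D; last first.
  by right; left; left; apply: closed_in_Hnn B0 BT noB => //; lia.
have [c [cc uc longest]] := longest_cycle D.
have [a [b ab]] : exists a b, D a b.
  have /card_gt0P[a _] : 0 < #|V| by rewrite cardV; lia.
  have /card_gt0P[b] : 0 < #|out_nbr D a| by apply: leq_trans (out a); lia.
  by rewrite inE => ab; exists a, b.
(* The maximum alone could be attained by the empty sequence, whereas a bypass needs two distinct
   vertices on the cycle. *)
have c_gt1 : 1 < size c.
  have [c' [cc' uc' c'1]] := strong_cycle D_loopless strongD ab.
  exact: leq_trans c'1 (longest c' cc' uc').
have [sc|sc] := eqVneq (size c) #|V|.
  by left; apply: cycle_hamiltonian sc.
have not_ham : ~ hamiltonian D.
  case=> c' [_ /andP[cc' uc'] c'V]; case/eqP: sc; apply/eqP; rewrite eqn_leq.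
  rewrite -{1}(card_uniqP uc) max_card; apply: leq_trans (longest c' cc' uc').
  rewrite -(card_uniqP uc'); apply/subset_leq_card/subsetP => z _; exact: c'V.
right; have [w wc] : exists w, w \notin c.
  apply/existsP; apply: contraNT sc; rewrite negb_exists => /forallP cV.
  by rewrite -(card_uniqP uc); apply/eqP/eq_card => z; rewrite inE; apply/negPn.
have [c1 [c2 [c1c c2c c12]]] : exists c1 c2, [/\ c1 \in c, c2 \in c & c1 != c2].
  case: (c) c_gt1 uc => [|c1 [|c2 s]] // _ /andP[c1s _].
  exists c1, c2; split; rewrite ?inE ?eqxx ?orbT //.
  by apply: contraNneq c1s => ->; rewrite mem_head.
have n0 : 0 < n by lia.
have [x0 [x1 [u [[x0c x1c x01 u0] [pu uC uu]]]]] :=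
  bypass_exists (C := mem c) D_loopless cardV min_degree n0 strongD c1c c2c c12 wc.
have [q [g [th sz]]] := bypass_theta cc uc x0c x1c x01 u0 pu uC uu.
have [x [q' [g' [u' [th' free sz']]]]] := theta_shortcut_free th.
have longest' c' : cycle D c' -> uniq c' -> size c' <= size (x :: q' ++ g').
  by rewrite sz' sz; apply: longest.
have [Y tb] := theta_two_blobs D_loopless cardV n3 min_degree out ind longest' th' free erefl.
have [g1|g_neq1] := eqVneq (size g') 1.
  have [p ip] := single_blob_interlaced cardV n3 tb g1.
  have nE : n.-1.+1 = n by move: n3; clear; lia.
  have dense : nonham_dense n.-1 D.
    split=> // [z|z|z|].
    - by apply: leq_trans (min_degree z); move: n3; clear; lia.
    - by apply: leq_trans (out z); rewrite subn1.
    - by apply: leq_trans (ind z); rewrite subn1.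
    by move: n3; clear; lia.
  have cardV' : #|V| = 2 * n.-1 + 2 by rewrite cardV; move: n3; clear; lia.
  have [Hnn|[iso|iso]] := interlaced_conclusion dense cardV' ip.
  - by left; right; rewrite -nE.
  - by right; apply: Or33; apply: Or41.
  by right; apply: Or33; apply: Or42.
have g_gt1 : 1 < size g' by have := blobs_G tb; move: g_neq1; clear; lia.
have q1 := large_blobs_path D_loopless cardV n3 out ind g_gt1 tb.
case: q' q1 th' free sz' longest' tb => [|l []] // _ _ _ _ _ tb.
have [iso|iso] := large_blobs_iso D_loopless cardV n3 out ind g_gt1 tb.
  by right; apply: Or31.
by right; apply: Or32.
Qed.
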